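(* Let $\alpha,\gamma,\mu>0$ and $0<T<\infty$. The symmetric equilibrium arrival distribution for the two-customer game with index costs and with arrivals allowed only in the interval $[0,T]$ is given by the following, where $p_0$ is the probability of arriving at time zero: (1) If $\frac{\alpha}{\mu}(1-2e^{-\mu T})\le\gamma$ then $p_0=1$, i.e. both customers arrive at time zero and are admitted into service in random order. The expected cost for each customer is $\frac12\left(\frac{\alpha}{\mu}+\gamma\right)$. (2) If $\frac{\alpha}{\mu}(1-2e^{-\mu T})>\gamma$ then, with $t^e=-\frac{1}{\mu}\log\left(\frac12\left(1-\frac{\gamma\mu}{\alpha}\right)\right)$, $$p_0=\frac{2}{1+\frac{\alpha}{\gamma\mu}-\left(\frac{\alpha}{\gamma\mu}-1\right)e^{-\frac{\mu}{1+\frac{\alpha}{\gamma\mu}}(T-t^e)}}$$ and the distribution on $(0,T]$ has density $$f(t)=\frac{p_0\mu}{2}\,\frac{\frac{\alpha}{\gamma\mu}-1}{\frac{\alpha}{\gamma\mu}+1}\,e^{-\frac{\mu}{1+\frac{\alpha}{\gamma\mu}}(t-t^e)}\,\mathbf{1}_{\{t\in[t^e,T]\}}.$$ The expected cost is $\frac{p_0}{2}\left(\frac{\alpha}{\mu}+\gamma\right)$ for each customer.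
   Context: Model. There are two customers, each choosing (possibly at random, independently) an arrival time $t\in[0,T]$. A single server starts operating at time $0$ and serves First Come First Served; service times are i.i.d. exponential with rate $\mu$. All who arrived by the closing time $T$ are served, even after $T$. Customers arriving at exactly the same time are admitted in uniformly random order. Each customer pays $\alpha$ per unit of time from arrival until admission into service, and $\gamma$ if the other customer is ahead of him in the arrival order. When the other customer arrives according to a cdf $F$, the expected cost of arriving at $t\in[0,T]$ is $$c_F(t)=\frac{\alpha}{\mu}\mathbb{E}Q_F(t)+\gamma\,\mathbb{E}A_F(t),$$ where $A_F(t)\in\{0,1\}$ indicates whether the other customer has arrived up to time $t$ and $Q_F(t)\in\{0,1\}$ whether he is present in the system at time $t$; if $F$ has an atom at $t$, a simultaneous arrival counts only if placed ahead by the random tie-breaking (so $c_F(0)=\frac{p_0}{2}(\frac{\alpha}{\mu}+\gamma)$ with $p_0=F(0)$). A symmetric equilibrium arrival distribution is a cdf $F$ for which there is a constant $c_e$ (the equilibrium cost) such that $c_F(t)=c_e$ for all $t$ in the support of $F$ and $c_F(t)\ge c_e$ for every admissible $t$. Only distributions $F$ whose support is, on any finite interval, a finite union of closed intervals and points are considered. *)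

(* Defs.v *)
From mathcomp Require Import all_boot all_order all_algebra.
From mathcomp Require Import all_classical all_reals all_analysis.
Import Order.TTheory GRing.Theory Num.Theory.
Import numFieldNormedType.Exports.

Set Implicit Arguments.
Unset Strict Implicit.
Unset Printing Implicit Defensive.

Local Open Scope classical_set_scope.
Local Open Scope ring_scope.

(* A cdf F is represented by the Borel probability measure on the real line
   that it determines. *)
Notation law R := (probability (measurableTypeR R) R).

Section TwoCustomerGame.
Context {R : realType}.

(* The positivity proof is an implicit argument of the library's instance
   making exponential_prob mu a probability; unshelve exposes it. *)
Definition service_law (mu : R) (mu_gt0 : 0 < mu) : law R.
Proof. by unshelve refine (exponential_prob mu : law R). Defined.

(* An outcome w consists of the arrival time w.1 of the other customer, his
   service time w.2.1, and a fair coin w.2.2, which is true when a simultaneous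
   arrival is resolved in his favour. The three are independent. *)
Notation outcome := (measurableTypeR R * (measurableTypeR R * bool))%type.

Definition outcome_law (mu : R) (mu_gt0 : 0 < mu) (F : law R) :
    probability outcome R :=
  (F \x (service_law mu_gt0 \x bernoulli_prob 2^-1))%E.

(* The event A_F(t) = 1. *)
Definition other_ahead (t : R) : set outcome :=
  [set w | w.1 < t \/ w.1 = t /\ w.2.2 = true].

(* The event Q_F(t) = 1. If the other customer is ahead, he arrived at a time
   w.1 >= 0 at which the server was free, so he departs at w.1 + w.2.1. *)
Definition other_present (t : R) : set outcome :=
  [set w | other_ahead t w /\ t < w.1 + w.2.1].

(* c_F(t); both expectations are finite. *)
Definition expected_cost (alpha gamma mu : R) (mu_gt0 : 0 < mu) (F : law R)
    (t : R) : R :=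
  alpha / mu * fine ('E_(outcome_law mu_gt0 F)[\1_(other_present t)])%E +
  gamma * fine ('E_(outcome_law mu_gt0 F)[\1_(other_ahead t)])%E.

Definition support (F : law R) : set R :=
  [set x | forall U : set R, open_nbhs x U -> (0 < F U)%E].

(* Isolated points are the intervals with equal endpoints. *)
Definition finite_union_of_intervals (A : set R) : Prop :=
  exists s : seq (R * R), (forall i, i \in s -> i.1 <= i.2) /\
    A = [set x | exists2 i, i \in s & i.1 <= x <= i.2].

Definition admissible (T : R) (F : law R) : Prop :=
  F `[0, T]%classic = 1%E /\
  forall a b, finite_union_of_intervals (support F `&` `[a, b]%classic).

Definition symmetric_equilibrium (alpha gamma mu : R) (mu_gt0 : 0 < mu) (T : R)
    (F : law R) (c_e : R) : Prop :=
  [/\ admissible T F,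
      forall t, support F t -> expected_cost alpha gamma mu_gt0 F t = c_e
    & forall t, 0 <= t <= T -> c_e <= expected_cost alpha gamma mu_gt0 F t].

(* Laws are compared on Borel sets only, the values of a measure on other sets
   being irrelevant. *)
Definition unique_symmetric_equilibrium (alpha gamma mu : R) (mu_gt0 : 0 < mu)
    (T : R) (F : law R) (c_e : R) : Prop :=
  symmetric_equilibrium alpha gamma mu_gt0 T F c_e /\
  forall (G : law R) (c : R), symmetric_equilibrium alpha gamma mu_gt0 T G c ->
    (forall B : set (measurableTypeR R), measurable B -> G B = F B) /\ c = c_e.

End TwoCustomerGame.

(* Main.v *)
Require Import Defs.
From HB Require Import structures.
From mathcomp Require Import all_boot all_order all_algebra.
From mathcomp Require Import all_classical all_reals all_analysis.
From mathcomp Require Import measurable_realfun ring lra.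
Import Order.TTheory GRing.Theory Num.Theory.
Import numFieldNormedType.Exports.

Set Implicit Arguments.
Unset Strict Implicit.
Unset Printing Implicit Defensive.

Local Open Scope classical_set_scope.
Local Open Scope ring_scope.

(** Let [a = alpha / mu], [H t = F ]-oo, t]], and let [y t] be the integral of
[exp (- mu (t - x))] over [x <= t] under [F], so that the cost is
[a y + gamma H] away from atoms.  If [H s = H t] with [s <= t], then
[y t = exp (- mu (t - s)) y s], so the cost strictly decreases wherever [F] puts
no mass.  For every [t] there is a point [u <= t] of the support with
[H u = H t]; in an equilibrium the decrease of the cost after a support point
[u > 0] forces [u = t].  Hence every [t > 0] either satisfies [H t = F {0}] or is
indifferent, and comparing the two expressions of the cost puts the switch at
[t^e].  After [t^e] indifference turns into the equation
[y' = - mu gamma / (a + gamma) y], and [H T = 1] fixes [F {0}].  Atoms at [t > 0]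
are impossible because arriving just before one is cheaper.  Derivatives of [y]
are avoided: between [s] and [t] the increments of [y] and [H] bound each other
up to [O((t - s)^2)], and a function with quadratic increments is constant. *)

(** * Bounds on the exponential and functions with quadratic increments *)

Lemma expRN_ge1B (R : realType) (x : R) : 1 - x <= expR (- x).
Proof. exact: expR_ge1Dx. Qed.

Lemma expRN_le1 (R : realType) (x : R) : 0 <= x -> expR (- x) <= 1.
Proof. by move=> x0; rewrite -expR0 ler_expR oppr_le0. Qed.

(** Since [(1 - x + x^2) (1 + x) = 1 + x^3 >= 1] and [1 + x <= expR x]. *)
Lemma expRN_le_quadratic (R : realType) (x : R) :
  0 <= x -> expR (- x) <= 1 - x + x ^+ 2.
Proof.
move=> x0; rewrite expRN -div1r ler_pdivrMr ?expR_gt0//.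
have /ler_wpM2l : 1 + x <= expR x by exact: expR_ge1Dx.
have q0 : 0 <= 1 - x + x ^+ 2 by nra.
move=> /(_ _ q0); apply: le_trans.
have : 0 <= x ^+ 3 by exact: exprn_ge0.
rewrite !exprS; nra.
Qed.

(** Cut [[a, t]] into [n + 1] equal steps: the increments add up to at most [C (t - a)^2 / (n + 1)],
    which is arbitrarily small. *)
Lemma quadratic_increment_eq (R : realType) (z : R -> R) (a b C : R) :
  (forall s t, a <= s -> s <= t -> t <= b -> `|z t - z s| <= C * (t - s) ^+ 2) ->
  forall t, a <= t <= b -> z t = z a.
Proof.
move=> zC t /andP[lat ltb].
have step (n m : nat) : (m <= n.+1)%N ->
    `|z (a + m%:R * ((t - a) / n.+1%:R)) - z a|
    <= m%:R * (C * ((t - a) / n.+1%:R) ^+ 2).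
  set d := (t - a) / n.+1%:R.
  have d0 : 0 <= d by rewrite divr_ge0// subr_ge0.
  have dn : n.+1%:R * d = t - a by rewrite mulrC divfK// pnatr_eq0.
  elim: m => [|m IH] mn; first by rewrite !mul0r addr0 subrr normr0.
  have mn1 : (m.+1%:R : R) * d <= t - a by rewrite -dn ler_wpM2r// ler_nat.
  have m0 : 0 <= m%:R * d by rewrite mulr_ge0.
  rewrite -(subrKA (z (a + m%:R * d))) (le_trans (ler_normD _ _))//.
  rewrite -[m.+1]addn1 natrD [X in _ <= X]mulrDl mul1r [X in _ <= X]addrC.
  apply: lerD; last exact/IH/ltnW.
  have := zC (a + m%:R * d) (a + (m%:R + 1) * d).
  have -> : a + (m%:R + 1) * d - (a + m%:R * d) = d by ring.
  move: mn1; rewrite -[m.+1]addn1 natrD => mn1.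
  by apply; lra.
have bound (n : nat) : n.+1%:R * `|z t - z a| <= C * (t - a) ^+ 2.
  have := step n n.+1 (leqnn _).
  have n0 : (n.+1%:R : R) != 0 by rewrite pnatr_eq0.
  rewrite [n.+1%:R * (_ / _)]mulrC divfK// subrKC.
  move=> /(ler_wpM2l (ler0n _ n.+1)) /le_trans; apply.
  by rewrite le_eqVlt; apply/orP; left; apply/eqP; field; rewrite addrC -natr1 in n0 *.
apply/eqP; rewrite -subr_eq0 -normr_eq0 eq_le normr_ge0 andbT leNgt.
apply/negP => zpos.
(* With this [N] the left side of [bound N] exceeds the right one. *)
pose N := Num.truncn (C * (t - a) ^+ 2 / `|z t - z a|).
have := bound N; apply/negP; rewrite -ltNge -ltr_pdivrMr//.
exact: truncnS_gt.
Qed.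

(** The integrating factor [expR (k * (x - a))] turns [y] into a function with quadratic increments.
    As [0 <= k], the factor stays below its value at [b], which is absorbed into the constant. *)
Lemma exponential_decay (R : realType) (y : R -> R) (k a b C : R) : 0 <= k ->
  (forall s t, a <= s -> s <= t -> t <= b ->
    `|y t - expR (- (k * (t - s))) * y s| <= C * (t - s) ^+ 2) ->
  forall t, a <= t <= b -> y t = expR (- (k * (t - a))) * y a.
Proof.
move=> k0 yC t atb.
suff <- : expR (k * (t - a)) * y t = y a.
  by rewrite mulrA -expRD addNr expR0 mul1r.
have -> : y a = expR (k * (a - a)) * y a by rewrite subrr mulr0 expR0 mul1r.
pose z x := expR (k * (x - a)) * y x.
apply: (@quadratic_increment_eq _ z a b (expR (k * (b - a)) * C)) => // s u sa su ub.
have -> : z u - z s = expR (k * (u - a)) * (y u - expR (- (k * (u - s))) * y s).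
  rewrite /z (_ : expR (k * (s - a)) = expR (k * (u - a)) * expR (- (k * (u - s)))).
    ring.
  by rewrite -expRD; congr expR; ring.
rewrite normrM ger0_norm ?expR_ge0// -mulrA.
have le_b : expR (k * (u - a)) <= expR (k * (b - a)).
  by rewrite ler_expR ler_wpM2l// lerB.
apply: (le_trans (ler_wpM2l (expR_ge0 _) (yC _ _ sa su ub))).
(* The quadratic bound is nonnegative because it dominates an absolute value. *)
by apply: ler_wpM2r => //; apply: le_trans (yC _ _ sa su ub).
Qed.

(** * Backlog of a law of arrivals *)

Definition cdf_at (R : realType) (F : law R) (t : R) : R := fine (F `]-oo, t]%classic).
Definition atom (R : realType) (F : law R) (t : R) : R := fine (F [set t]).

(** For [A] within []-oo, t]] this is the probability that the other customer arrives in [A] and is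
    still in service at [t]. Keeping [A] and [t] apart allows splitting the set and moving the time
    separately. *)
Definition discounted (R : realType) (mu : R) (F : law R) (A : set R) (t : R) : \bar R :=
  (\int[F]_(x in A) (expR (- (mu * (t - x))))%:E)%E.

(* P(Q_F(t) = 1), except that a simultaneous arrival counts as ahead for sure. *)
Definition backlog (R : realType) (mu : R) (F : law R) (t : R) : R :=
  fine (discounted mu F `]-oo, t]%classic t).

Section Discounted.
Context (R : realType) (mu : R) (F : law R).
Hypothesis mu_gt0 : 0 < mu.
Implicit Types (s t : R) (A : set (measurableTypeR R)).

Let F_fin A : measurable A -> F A \is a fin_num.
Proof. exact: fin_num_measure. Qed.

Lemma cdf_atE t : F `]-oo, t]%classic = (cdf_at F t)%:E.
Proof. by rewrite fineK// F_fin. Qed.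

Lemma atomE t : F [set t] = (atom F t)%:E.
Proof. by rewrite fineK// F_fin. Qed.

Lemma cdf_at_ge0 t : 0 <= cdf_at F t.
Proof. by rewrite fine_ge0. Qed.

Lemma atom_ge0 t : 0 <= atom F t.
Proof. by rewrite fine_ge0. Qed.

Lemma cdf_at_le1 t : cdf_at F t <= 1.
Proof. by rewrite -lee_fin -cdf_atE probability_le1. Qed.

Lemma cdf_at_sub s t : s <= t -> F `]s, t]%classic = (cdf_at F t - cdf_at F s)%:E.
Proof.
move=> st; have -> : `]s, t]%classic = `]-oo, t] `\` `]-oo, s].
  apply/seteqP; split => x /=; rewrite !in_itv/=.
    by move=> /andP[sx ->]; split => //; apply/negP; rewrite -ltNge.
  by move=> [-> /negP]; rewrite -ltNge => ->.
rewrite measureD//= ?setIidr//.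
- by rewrite !cdf_atE -EFinB.
- exact: subset_itvl.
- by rewrite cdf_atE ltry.
Qed.

Lemma cdf_at_mono : {homo cdf_at F : s t / s <= t}.
Proof.
move=> s t st; rewrite -subr_ge0 -lee_fin -cdf_at_sub//.
Qed.

Lemma cdf_at_open t : F `]-oo, t[%classic = (cdf_at F t - atom F t)%:E.
Proof.
rewrite EFinB -cdf_atE -atomE.
have -> : `]-oo, t[%classic = `]-oo, t] `\ t.
  apply/seteqP; split => x /=; rewrite !in_itv/=.
    by move=> xt; split; [exact: ltW|move=> xE; rewrite xE ltxx in xt].
  by move=> [xt /eqP nxt]; rewrite lt_neqAle nxt.
rewrite measureD//=; last by rewrite cdf_atE ltry.
by rewrite setIidr// => _ ->/=; rewrite in_itv/=.
Qed.

Lemma atom_le s t : s < t -> atom F t <= cdf_at F t - cdf_at F s.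
Proof.
move=> st; rewrite -lee_fin -atomE -cdf_at_sub ?(ltW st)//.
by rewrite le_measure ?inE// => _ ->/=; rewrite in_itv/= st lexx.
Qed.

Lemma measurable_discount t A :
  measurable_fun A (EFin \o (fun x : measurableTypeR R => expR (- (mu * (t - x))))).
Proof.
apply/measurable_EFinP; apply: measurable_funTS.
apply: (@measurableT_comp _ _ _ _ _ _ expR) => //.
apply: continuous_measurable_fun => x.
by apply: cvgN; apply: cvgMr; apply: cvgB; [exact: cvg_cst|exact: cvg_id].
Qed.

Lemma discounted_ge0 A t : (0 <= discounted mu F A t)%E.
Proof. by apply: integral_ge0 => x _; rewrite lee_fin expR_ge0. Qed.

Lemma discounted_le A t (c : R) : measurable A -> 0 <= c ->
  (forall x, A x -> expR (- (mu * (t - x))) <= c) -> (discounted mu F A t <= c%:E * F A)%E.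
Proof.
move=> mA c0 Ac; rewrite -(integral_cst F mA c%:E).
apply: ge0_le_integral => //.
exact: measurable_discount.
Qed.

Lemma discounted_ge A t (c : R) : measurable A -> 0 <= c ->
  (forall x, A x -> c <= expR (- (mu * (t - x)))) -> (c%:E * F A <= discounted mu F A t)%E.
Proof.
move=> mA c0 Ac; rewrite -(integral_cst F mA c%:E).
apply: ge0_le_integral => //.
exact: measurable_discount.
Qed.

Lemma discountedU A B t : measurable A -> measurable B -> [disjoint A & B] ->
  discounted mu F (A `|` B) t = (discounted mu F A t + discounted mu F B t)%E.
Proof.
move=> mA mB AB; apply: ge0_integral_setU => //.
exact: measurable_discount.
Qed.

(** Memorylessness of the service time: the ratio of the two discounts does not depend on the
    arrival time. *)
Lemma discounted_shift A s t : measurable A ->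
  discounted mu F A t = ((expR (- (mu * (t - s))))%:E * discounted mu F A s)%E.
Proof.
move=> mA; rewrite /discounted -ge0_integralZl//.
- by apply: eq_integral => x _; rewrite -EFinM -expRD; congr (expR _)%:E; ring.
- exact: measurable_discount.
Qed.

Lemma discounted_fin A t : measurable A -> A `<=` `]-oo, t] ->
  discounted mu F A t \is a fin_num.
Proof.
move=> mA At; rewrite ge0_fin_numE ?discounted_ge0//.
apply: (@le_lt_trans _ _ (1%:E * F A)%E); last by rewrite mul1e -ge0_fin_numE ?F_fin.
apply: discounted_le => // x /At/=; rewrite in_itv/= => xt.
by rewrite expRN_le1// mulr_ge0 ?(ltW mu_gt0)// subr_ge0.
Qed.

Lemma backlogE t : discounted mu F `]-oo, t]%classic t = (backlog mu F t)%:E.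
Proof. by rewrite fineK// discounted_fin. Qed.

Lemma backlog_ge0 t : 0 <= backlog mu F t.
Proof. by rewrite fine_ge0// discounted_ge0. Qed.

Lemma backlog_le t : backlog mu F t <= cdf_at F t.
Proof.
rewrite -lee_fin -backlogE -cdf_atE -[leRHS]mul1e.
apply: discounted_le => // x /=; rewrite in_itv/= => xt.
by rewrite expRN_le1// mulr_ge0 ?(ltW mu_gt0)// subr_ge0.
Qed.

(** The backlog at [s] survives with factor [e], while the mass [d] of []s, t]] enters with weights
    between [e] and 1. *)
Lemma backlog_increment s t (e := expR (- (mu * (t - s))))
    (d := cdf_at F t - cdf_at F s) : s <= t ->
  e * (backlog mu F s + d) <= backlog mu F t <= e * backlog mu F s + d.
Proof.
move=> st.
have dE : F `]s, t]%classic = d%:E by rewrite cdf_at_sub.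
have yE : ((backlog mu F t)%:E =
    e%:E * (backlog mu F s)%:E + discounted mu F `]s, t]%classic t)%E.
  rewrite -!backlogE /e -discounted_shift//.
  rewrite -discountedU//; last by apply/disj_setPLR => x /=; rewrite !in_itv/= leNgt => /negbTE ->.
  congr (discounted _ _ _ _); apply/seteqP; split => x /=; rewrite !in_itv/=.
    by move=> xt; case: (leP x s) => xs; [left|right].
  by move=> [/le_trans|/andP[]//]; exact.
have fd : discounted mu F `]s, t]%classic t \is a fin_num.
  by apply: discounted_fin => // x /=; rewrite !in_itv/= => /andP[].
rewrite mulrDr -!lee_fin yE (EFinD _ (e * d)) (EFinD _ d) (EFinM e d).
apply/andP; split.
  apply: leeD => //; rewrite -dE.
  apply: discounted_ge; rewrite ?expR_ge0// => x /=; rewrite in_itv/= => /andP[sx xt].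
  by rewrite ler_expR lerN2 ler_wpM2l ?(ltW mu_gt0)// lerB// ltW.
apply: leeD => //; rewrite -dE -[leRHS]mul1e.
apply: discounted_le => // x /=; rewrite in_itv/= => /andP[sx xt].
by rewrite expRN_le1// mulr_ge0 ?(ltW mu_gt0)// subr_ge0.
Qed.

(** At [x = t] the discount is 1, so dropping this point removes exactly its mass. *)
Lemma backlog_open t :
  discounted mu F `]-oo, t[%classic t = (backlog mu F t - atom F t)%:E.
Proof.
apply/eqP; rewrite EFinB eq_sym sube_eq//; last by rewrite fin_num_adde_defl.
rewrite -backlogE.
have -> : (atom F t)%:E = discounted mu F [set t] t.
  rewrite -atomE -[LHS]mul1e; apply/eqP; rewrite eq_le; apply/andP; split.
    by apply: discounted_ge => // x ->; rewrite subrr mulr0 oppr0 expR0.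
  by apply: discounted_le => // x ->; rewrite subrr mulr0 oppr0 expR0.
rewrite -discountedU//; last first.
  by apply/disj_setPLR => x /=; rewrite in_itv/= => + xt; rewrite xt ltxx.
apply/eqP; congr (discounted _ _ _ _); apply/seteqP; split => x /=; rewrite !in_itv/=.
  by rewrite le_eqVlt => /orP[/eqP|]; [right|left].
by move=> [/ltW//|->].
Qed.

End Discounted.

(** * Support of a law and its determination by the cdf *)

Lemma open_null_not_support (R : realType) (F : law R) (U : set R) (x : R) :
  open U -> U x -> F U = 0%E -> ~ Defs.support F x.
Proof. by move=> oU Ux FU /(_ U (conj oU Ux)); rewrite FU ltxx. Qed.

Lemma support_atom (R : realType) (F : law R) (t : R) : 0 < atom F t -> Defs.support F t.
Proof.
move=> p0 U [oU Ut]; apply: lt_le_trans (_ : F [set t] <= F U)%E.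
  by rewrite atomE lte_fin.
apply: le_measure; rewrite ?inE//=; first exact: open_measurable.
by move=> _ ->.
Qed.

(** Continuity of the measure from above along []-oo, t + 1 / (n + 1)]]. *)
Lemma cdf_at_right_continuous (R : realType) (F : law R) (t c : R) :
  cdf_at F t < c -> exists2 v, t < v & cdf_at F v < c.
Proof.
move=> tc.
pose A n : set (measurableTypeR R) := `]-oo, (t + n.+1%:R^-1)%R]%classic.
have FA : F (A n) @[n --> \oo] --> (cdf_at F t)%:E.
  have : F (A n) @[n --> \oo] --> F (\bigcap_n A n).
    apply: nonincreasing_cvg_mu => [| | |m n mn]. 
    - by apply: (@le_lt_trans _ _ 1%E); [exact: (probability_le1 F (measurable_itv _))|exact: ltry].
    - by move=> i; exact: measurable_itv.
    - by apply: bigcap_measurable => // ? _; exact: measurable_itv.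
    - apply/subsetPset; apply: subset_itvl.
      by rewrite bnd_simp lerD2l lef_pV2 ?posrE// ler_nat.
  by rewrite -cdf_atE /A -itvNycEbigcap.
have := cvgr_lt (cdf_at F t) (fine_cvg FA) c tc.
move=> [n _ /(_ n (leqnn n))/= nc].
by exists (t + n.+1%:R^-1) => //; rewrite ltrDl invr_gt0.
Qed.

Lemma support_cdf_eq (R : realType) (F : law R) (s t : R) :
  cdf_at F s < cdf_at F t ->
  exists u, [/\ s < u, u <= t, Defs.support F u & cdf_at F u = cdf_at F t].
Proof.
move=> st.
(* The witness is the infimum of the points where the cdf reaches its value at [t]. *)
pose S := [set x | cdf_at F t <= cdf_at F x].
have St : S t by exact: lexx.
have lbS x : S x -> s < x.
  move=> Sx; rewrite ltNge; apply/negP => xs.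
  by have := le_lt_trans (le_trans Sx (cdf_at_mono F xs)) st; rewrite ltxx.
have infS : has_inf S by split; [exists t|exists s => x /lbS/ltW].
have ut : inf S <= t by apply: inf_lbound; case: infS.
(* Right continuity makes the infimum itself a point of [S]. *)
have Su : cdf_at F t <= cdf_at F (inf S).
  rewrite leNgt; apply/negP => /cdf_at_right_continuous[v uv vt].
  have : v <= inf S.
    apply: lb_le_inf; first by exists t.
    move=> x Sx; rewrite leNgt; apply/negP => xv.
    by have := le_lt_trans (le_trans Sx (cdf_at_mono F (ltW xv))) vt; rewrite ltxx.
  by rewrite leNgt uv.
exists (inf S); split => //; first exact: lbS.
  move=> U [/= oU Uu].
  have /nbhs_ballP[e /= e0 eU] := open_nbhs_nbhs (conj oU Uu).
  (* To the left of the infimum the cdf is strictly smaller, so every short interval ending there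
     carries mass. *)
  have le2 : inf S - e / 2 < inf S by rewrite ltrBlDr ltrDl divr_gt0.
  apply: (@lt_le_trans _ _ (F `]inf S - e / 2, inf S]%classic)).
    rewrite cdf_at_sub ?(ltW le2)// lte_fin subr_gt0.
    apply: lt_le_trans Su; rewrite ltNge; apply/negP => Se.
    by have := inf_lbound infS.2 Se; rewrite leNgt le2.
  apply: le_measure; rewrite ?inE//=; first exact: open_measurable.
  move=> x /=; rewrite in_itv/= => /andP[ex xu]; apply: eU.
  by rewrite /ball/= ger0_norm ?subr_ge0//; lra.
by apply/eqP; rewrite eq_le Su cdf_at_mono.
Qed.

(** The intervals []a, b]] are stable under intersection, generate the Borel sets and exhaust the
    line with finite mass. *)
Lemma law_ext (R : realType) (F G : law R) : cdf_at F =1 cdf_at G ->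
  forall B : set (measurableTypeR R), measurable B -> F B = G B.
Proof.
move=> FG B mB.
have FGi (a b : R) : F `]a, b]%classic = G `]a, b]%classic.
  have [ab|ba] := leP a b; first by rewrite !cdf_at_sub// !FG.
  by rewrite set_itv_ge ?measure0// bnd_simp -leNgt ltW.
apply: (@measure_unique _ R (measurableTypeR R) (@ocitv R)
  (fun n => `](- n%:R)%R, n%:R%R]%classic)) => //.
- exact: ocitvI.
- by move=> n; apply/is_ocitv.
- apply/seteqP; split => // x _; exists (Num.truncn `|x|).+1 => //=.
  by rewrite in_itv/=; have := truncnS_gt `|x|; rewrite ltr_norml => /andP[-> /ltW->].
- by move=> _ [[a b] _ <-]/=; exact: FGi.
- move=> n; apply: (@le_lt_trans _ _ 1%E); last exact: ltry.
  exact: (probability_le1 F (measurable_itv _)).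
Qed.

(** * The expected cost *)

Section ExpectedCost.
Context (R : realType) (mu : R) (mu_gt0 : 0 < mu) (F : law R).

Lemma service_tail (s : R) : 0 <= s ->
  service_law mu_gt0 `]s, +oo[%classic = (expR (- (mu * s)))%:E.
Proof.
move=> s0.
have -> : `]s, +oo[%classic = ~` `]-oo, s]%classic by rewrite setCitvl.
rewrite probability_setC//.
have -> : service_law mu_gt0 `]-oo, s]%classic = exponential_prob mu `[0, s]%classic.
  rewrite /= /exponential_prob [LHS]integral_mkcond [RHS]integral_mkcond.
  apply: eq_integral => x _; rewrite !patchE !mem_setE !in_itv/=.
  by have [//|x0] := leP 0 x; rewrite lt0_exponential_pdf ?if_same.
(* [exponential_prob_itv0c] is applied with [0 < s]; at [s = 0] the interval is a single null
   point. *)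
have [->|sn0] := eqVneq s 0.
  rewrite set_itv1 /exponential_prob integral_set1 mulr0 oppr0 expR0.
  by rewrite sube0.
rewrite exponential_prob_itv0c ?lt_def ?sn0//.
by rewrite oppeB// addeA subee// add0e mulNr.
Qed.

Let m2 := (service_law mu_gt0 \x bernoulli_prob 2^-1)%E.

Lemma measurable_other_ahead (t : R) :
  measurable (other_ahead t : set (measurableTypeR R * (measurableTypeR R * bool))).
Proof.
have -> : (other_ahead t : set (measurableTypeR R * (measurableTypeR R * bool))) =
   `]-oo, t[%classic `*` setT `|` [set t] `*` (setT `*` [set true]).
  apply/seteqP; split => -[x [s b]]; rewrite /other_ahead /= in_itv/=.
    by move=> [?|[? ?]]; [left|right].
  by move=> [[? _]|[? [_ ?]]]; [left|right].
apply: measurableU; first exact: measurableX.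
apply: measurableX => //; exact: measurableX.
Qed.

Lemma measurable_other_present (t : R) :
  measurable (other_present t : set (measurableTypeR R * (measurableTypeR R * bool))).
Proof.
apply: measurableI; first exact: measurable_other_ahead.
pose f (w : measurableTypeR R * (measurableTypeR R * bool)) : measurableTypeR R :=
  w.1 + w.2.1.
have mf : measurable_fun setT f.
  apply: measurable_funD => //.
  exact: (measurableT_comp measurable_fst measurable_snd).
rewrite [X in measurable X](_ : _ = f @^-1` `]t, +oo[%classic).
  by rewrite -[X in measurable X]setTI; apply: mf.
by apply/seteqP; split => w /=; rewrite in_itv/= andbT.
Qed.

(** Fubini in the arrival time of the other customer. Both events of the model have empty sections
    after [t], and the coin intervenes only at [t] itself, hence the three cases. *)
Lemma outcome_lawE (t v : R) (u : R -> R)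
    (A : set (measurableTypeR R * (measurableTypeR R * bool))) :
  measurable_fun setT (u : measurableTypeR R -> measurableTypeR R) ->
  (forall x, 0 <= u x) -> 0 <= v ->
  (forall x, x < t -> m2 (xsection A x) = (u x)%:E) ->
  m2 (xsection A t) = v%:E ->
  (forall x, t < x -> xsection A x = set0) ->
  outcome_law mu_gt0 F A =
    (\int[F]_(x in `]-oo, t[) (u x)%:E + v%:E * F [set t])%E.
Proof.
move=> mu_ u0 v0 Alt At Agt.
rewrite -integral_cst// [X in (X + _)%E]integral_mkcond [X in (_ + X)%E]integral_mkcond.
rewrite -ge0_integralD//.
- apply: eq_integral => x _; rewrite !patchE !mem_setE in_itv/=.
  transitivity (m2 (xsection A x)) => //.
  have [xt|tx|->] := ltgtP x t.
  - by rewrite (Alt x xt) memNset ?adde0// => xE; rewrite /= xE ltxx in xt.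
  - rewrite (Agt x tx) memNset; last by move=> xE; rewrite /= xE ltxx in tx.
    by rewrite adde0; exact: measure0.
  - by rewrite At mem_set// add0e.
- by move=> x _; apply: erestrict_ge0 => y _; rewrite lee_fin.
- apply/(measurable_restrictT _ _).1 => //; apply: measurable_funTS.
  exact/measurable_EFinP.
- by move=> x _; apply: erestrict_ge0 => y _; rewrite lee_fin.
- exact/(measurable_restrictT _ _).1.
Qed.

Lemma coin_head : bernoulli_prob 2^-1 [set true] = (2^-1 : R)%:E.
Proof.
rewrite bernoulli_probE; last by rewrite invr_ge0 ler0n invf_le1// ler1n.
by rewrite !diracE mem_set// memNset// mule1 mule0 adde0.
Qed.

Let m2E A B : measurable A -> measurable B ->
  m2 (A `*` B) = (service_law mu_gt0 A * bernoulli_prob 2^-1 B)%E.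
Proof. by move=> mA mB; rewrite /m2 product_measure1E. Qed.

(** An earlier arrival always counts, a simultaneous one only if the coin favours it, that is with
    weight 1/2. *)
Lemma outcome_law_ahead (t : R) :
  outcome_law mu_gt0 F (other_ahead t) = (cdf_at F t - atom F t / 2)%:E.
Proof.
rewrite (@outcome_lawE t (2^-1) (fun x => 1)) //.
- rewrite integral_cst// mul1e [X in (X + _)%E](cdf_at_open F t) atomE -EFinM -EFinD; congr _%:E.
  by field.
- move=> x xt; rewrite (_ : xsection _ _ = setT `*` setT).
    by rewrite m2E// !probability_setT mule1.
  by apply/seteqP; split => // -[s b] _; rewrite /xsection/= inE; left.
- rewrite (_ : xsection _ _ = setT `*` [set true]).
    by rewrite m2E// probability_setT mul1e coin_head.
  apply/seteqP; split => -[s b]; rewrite /xsection/= inE.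
    by move=> [/=|[]//]; rewrite ltxx.
  by move=> [_ /= ->]; right.
- move=> x tx; apply/seteqP; split => // -[s b]; rewrite /xsection/= inE.
  by move=> [/=|[]/=]; [rewrite ltNge (ltW tx)|move=> xt; rewrite xt ltxx in tx].
Qed.

(** A customer who came at [x < t] is still there if his service exceeds [t - x]. At [x = t] every
    positive service time suffices, so the coin alone decides. *)
Lemma outcome_law_present (t : R) :
  outcome_law mu_gt0 F (other_present t) = (backlog mu F t - atom F t / 2)%:E.
Proof.
rewrite (@outcome_lawE t (2^-1) (fun x => expR (- (mu * (t - x))))) //.
- rewrite [X in (X + _)%E](backlog_open F mu_gt0) atomE -EFinM -EFinD; congr _%:E.
  by field.
- by apply/measurable_EFinP; exact: measurable_discount.
- move=> x xt; rewrite (_ : xsection _ _ = `]t - x, +oo[%classic `*` setT).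
    by rewrite m2E// probability_setT mule1 service_tail// subr_ge0 ltW.
  apply/seteqP; split => -[s b]; rewrite /xsection/= inE /other_present/= in_itv/= andbT.
    by move=> [_]; rewrite ltrBlDl.
  by move=> [+ _]; rewrite ltrBlDl; split => //; left.
- rewrite (_ : xsection _ _ = `]0, +oo[%classic `*` [set true]).
    by rewrite m2E// service_tail// mulr0 oppr0 expR0 mul1e coin_head.
  apply/seteqP; split => -[s b]; rewrite /xsection/= inE /other_present/= in_itv/= andbT.
    by move=> [[/=|[_ /= ->]]]; rewrite ?ltxx// ltrDl.
  by move=> [+ /= ->]; rewrite ltrDl; split => //; right.
- move=> x tx; apply/seteqP; split => // -[s b]; rewrite /xsection/= inE.
  by move=> [[/=|[]/=]]; [rewrite ltNge (ltW tx)|move=> xt; rewrite xt ltxx in tx].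
Qed.

Lemma expected_costE (alpha gamma t : R) :
  expected_cost alpha gamma mu_gt0 F t =
    alpha / mu * (backlog mu F t - atom F t / 2) +
    gamma * (cdf_at F t - atom F t / 2).
Proof.
rewrite /expected_cost !expectation_indic//.
- by rewrite outcome_law_present outcome_law_ahead.
- exact: measurable_other_ahead.
- exact: measurable_other_present.
Qed.

End ExpectedCost.

(** * Necessary conditions for an equilibrium *)

Section Concentrated.
Context (R : realType) (mu T : R) (F : law R).
Hypothesis mu_gt0 : 0 < mu.
Hypothesis F_itv : F `[0, T]%classic = 1%E.

Lemma concentrated_null (A : set (measurableTypeR R)) : measurable A ->
  A `<=` ~` `[0, T]%classic -> F A = 0%E.
Proof.
move=> mA A0; apply/eqP; rewrite eq_le measure_ge0 andbT.
have <- : F (~` `[0, T]%classic) = 0%E.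
  by rewrite probability_setC// F_itv subee.
by rewrite le_measure ?inE//; exact: measurableC.
Qed.

Lemma cdf_at_lt0 t : t < 0 -> cdf_at F t = 0.
Proof.
move=> t0; rewrite /cdf_at concentrated_null// => x /=; rewrite !in_itv/= => xt.
by apply/negP; rewrite negb_and -ltNge (le_lt_trans xt t0).
Qed.

Lemma cdf_at_ge t : T <= t -> cdf_at F t = 1.
Proof.
move=> Tt; apply/eqP; rewrite eq_le cdf_at_le1/= -lee_fin -cdf_atE -F_itv.
rewrite le_measure ?inE// => x /=; rewrite !in_itv/= => /andP[_ xT].
exact: le_trans Tt.
Qed.

Lemma cdf_at0 : cdf_at F 0 = atom F 0.
Proof.
apply/eqP; rewrite -subr_eq0; apply/eqP/EFin_inj; rewrite -cdf_at_open.
apply: concentrated_null => // x /=; rewrite !in_itv/= => x0.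
by apply/negP; rewrite negb_and -ltNge x0.
Qed.

Lemma backlog0 : backlog mu F 0 = atom F 0.
Proof.
apply/eqP; rewrite -subr_eq0; apply/eqP/EFin_inj; rewrite -backlog_open//.
have F0 : F `]-oo, 0[%classic = 0%E.
  apply: concentrated_null => // x /=; rewrite !in_itv/= => x0.
  by apply/negP; rewrite negb_and -ltNge x0.
have : (discounted mu F `]-oo, 0%R[%classic 0%R <= 1%:E * F `]-oo, 0%R[%classic)%E.
  apply: discounted_le => // x /=; rewrite in_itv/= => x0.
  by rewrite expRN_le1// mulr_ge0 ?(ltW mu_gt0)// sub0r oppr_ge0 ltW.
by rewrite F0 mule0 => d0; apply/eqP; rewrite eq_le discounted_ge0 d0.
Qed.

Lemma support_itv t : Defs.support F t -> 0 <= t <= T.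
Proof.
move=> st; apply: contrapT => nt.
have oU : open (~` `[0, T]%classic : set R) by rewrite openC; exact: itv_closed.
have Ut : (~` `[0, T]%classic : set R) t by rewrite /= in_itv.
apply: (open_null_not_support oU Ut _ st).
by apply: concentrated_null => //; exact: measurableC.
Qed.

(** If []0, t]] carries no mass, the two bounds coincide and determine the backlog. *)
Lemma backlog_after_start t : 0 <= t ->
  expR (- (mu * t)) * cdf_at F t <= backlog mu F t <=
  expR (- (mu * t)) * atom F 0 + (cdf_at F t - atom F 0).
Proof.
move=> t0; have := backlog_increment F mu_gt0 t0.
by rewrite subr0 backlog0 cdf_at0 subrKC.
Qed.

End Concentrated.

(* The halves account for the fair resolution of simultaneous arrivals. *)
Definition reduced_cost (R : realType) (a g mu : R) (F : law R) (t : R) : R :=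
  a * (backlog mu F t - atom F t / 2) + g * (cdf_at F t - atom F t / 2).

Section Necessary.
Context (R : realType) (a g mu T c : R) (F : law R).
Hypotheses (a_gt0 : 0 < a) (g_gt0 : 0 < g) (mu_gt0 : 0 < mu) (T_gt0 : 0 < T).
Hypothesis F_itv : F `[0, T]%classic = 1%E.
Hypothesis cost_support : forall t, Defs.support F t -> reduced_cost a g mu F t = c.
Hypothesis cost_min : forall t, 0 <= t <= T -> c <= reduced_cost a g mu F t.

Notation H := (cdf_at F).
Notation y := (backlog mu F).
Notation p0 := (atom F 0).

(** Arriving at [s] just before [t] avoids the tie, a gain of [p (a + g) / 2]. The price is at most
    [a (1 - e) (y s + p)], because less service has elapsed, and it vanishes as [s] tends to [t]. *)
Lemma no_atom t : 0 < t <= T -> atom F t = 0.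
Proof.
move=> /andP[t0 tT]; apply/eqP; apply: contraT => pn0.
have {pn0} : 0 < atom F t by rewrite lt_def pn0 atom_ge0.
set p := atom F t => p_gt0.
have Ct := cost_support (support_atom p_gt0).
(* Since [y s + p <= 2], this keeps the price below [2 a mu d = p (a + g) / 4], half of the gain. *)
pose d := p * (a + g) / (8 * (a * mu)).
have am : 0 < a * mu by exact: mulr_gt0.
have d0 : 0 < d by rewrite divr_gt0// mulr_gt0// addr_gt0.
have [s [s0 st sd]] : exists s, [/\ 0 <= s, s < t & t - s <= d].
  (* The maximum with 0 keeps [s] an admissible arrival time. *)
  exists (Num.max 0 (t - d)); split.
  - by rewrite le_max lexx.
  - by rewrite gt_max t0/=; lra.
  - by rewrite lerBlDr -lerBlDl le_max lexx orbT.
have Cs := cost_min (_ : 0 <= s <= T).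
have /Cs {}Cs : 0 <= s <= T by rewrite s0/=; lra.
have ps := atom_ge0 F s.
have pH := atom_le F st; rewrite -/p in pH.
have /andP[yt _] := backlog_increment F mu_gt0 (ltW st).
have e1 := expRN_ge1B (mu * (t - s)).
have e0 := expR_ge0 (- (mu * (t - s))).
have ys := le_trans (backlog_le F mu_gt0 s) (cdf_at_le1 F s).
have ys0 := backlog_ge0 mu F s.
have p1 : p <= 1.
  by have := cdf_at_ge0 F s; have := cdf_at_le1 F t; lra.
have md : a * mu * (t - s) <= p * (a + g) / 8.
  have -> : p * (a + g) / 8 = a * mu * d.
    by rewrite /d; field; rewrite !gt_eqF.
  by rewrite ler_pM2l.
move: Cs Ct yt; rewrite /reduced_cost -/p.
set e := expR _ in e1 e0 *.
move=> Cs Ct yt.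
have yt' : e * (y s + p) <= y t.
  by apply: le_trans yt; rewrite ler_wpM2l// lerD2l.
have A1 : a * (e * (y s + p)) <= a * y t by rewrite ler_pM2l.
have A2 : g * (H s + p) <= g * H t by rewrite ler_pM2l//; lra.
(* The tie term at [s] can only lower the cost there. *)
have A3 : 0 <= (a + g) * atom F s by rewrite mulr_ge0// addr_ge0// ltW.
have A4 : a * (1 - e) * (y s + p) <= a * (mu * (t - s)) * 2.
  apply: ler_pM; [| |rewrite ler_pM2l//; lra|lra].
    rewrite mulr_ge0 ?(ltW a_gt0)// subr_ge0 expRN_le1// mulr_ge0 ?(ltW mu_gt0)//.
    by rewrite subr_ge0 ltW.
  by lra.
have A5 : 0 < p * (a + g) by rewrite mulr_gt0// addr_gt0.
have : p * (a + g) <= 0 by lra.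
by rewrite leNgt A5.
Qed.

Lemma cost_no_atom t : 0 < t <= T -> reduced_cost a g mu F t = a * y t + g * H t.
Proof. by move=> /no_atom p; rewrite /reduced_cost p mul0r !subr0. Qed.

Lemma cost_at0 : reduced_cost a g mu F 0 = p0 / 2 * (a + g).
Proof.
by rewrite /reduced_cost (backlog0 mu_gt0 F_itv) (cdf_at0 F_itv); field.
Qed.

Lemma support_cdf_eq_ge0 t : 0 <= t -> 0 < H t ->
  exists u, [/\ 0 <= u, u <= t, Defs.support F u & H u = H t].
Proof.
move=> t0 Ht; have := @support_cdf_eq _ F (-1) t.
rewrite (@cdf_at_lt0 _ T F F_itv) ?ltrN10// => /(_ Ht)[u [_ ut su Hu]].
by exists u; split => //; have /andP[] := support_itv F_itv su.
Qed.

(** Without mass at 0 arriving at 0 is free, so [c <= 0]; yet a support point where [H] has reached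
    1 costs at least [g]. *)
Lemma atom0_gt0 : 0 < p0.
Proof.
rewrite lt_def atom_ge0 andbT; apply/negP => /eqP p00.
have c0 : c <= 0.
  by have := cost_min (_ : 0 <= 0 <= T); rewrite cost_at0 p00 !mul0r lexx ltW//; apply.
have HT : H T = 1 by exact: cdf_at_ge F_itv _ _.
have [|u [u0 uT su Hu]] := support_cdf_eq_ge0 (ltW T_gt0); first by rewrite HT.
have pu : atom F u = 0.
  have [->//|un0] := eqVneq u 0.
  by apply: no_atom; rewrite uT lt_def un0 u0.
have := cost_support su; rewrite /reduced_cost pu mul0r !subr0 Hu HT.
have : 0 <= a * y u by rewrite mulr_ge0 ?backlog_ge0 ?ltW.
move=> ay yc; have : g <= 0 by lra.
by rewrite leNgt g_gt0.
Qed.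

Lemma equilibrium_cost : c = p0 / 2 * (a + g).
Proof. by rewrite -cost_at0 (cost_support (support_atom atom0_gt0)). Qed.

Lemma cdf_ge_atom0 t : 0 <= t -> p0 <= H t.
Proof. by rewrite -(cdf_at0 F_itv); exact: cdf_at_mono. Qed.

Lemma dichotomy t : 0 < t <= T ->
  (H t = p0 /\ a * (1 - 2 * expR (- (mu * t))) <= g /\ y t = expR (- (mu * t)) * p0)
  \/ a * y t + g * H t = c.
Proof.
move=> tT; have [t0 tleT] := andP tT.
have Ht : 0 < H t by apply: lt_le_trans atom0_gt0 (cdf_ge_atom0 (ltW t0)).
have [u [u0 ut su Hu]] := support_cdf_eq_ge0 (ltW t0) Ht.
have Ct : c <= a * y t + g * H t by rewrite -cost_no_atom// cost_min// ltW.
have [uE|un0] := eqVneq u 0.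
  left; have HE : H t = p0 by rewrite -Hu uE (cdf_at0 F_itv).
  have /andP[] := backlog_after_start mu_gt0 F_itv (ltW t0).
  rewrite HE subrr addr0 => y1 y2.
  have yE : y t = expR (- (mu * t)) * p0 by apply/eqP; rewrite eq_le y2 y1.
  split => //; split => //.
  (* Nobody arrives in []0, t]], so the cost at [t] is [p0 (a e + g)]; comparing it with [c] and
     dividing by [p0] gives the threshold inequality. *)
  move: Ct; rewrite yE HE equilibrium_cost => Ct.
  by rewrite -(ler_pM2l atom0_gt0); nra.
right; have u_gt0 : 0 < u by rewrite lt_def un0.
have uT : 0 < u <= T by rewrite u_gt0 (le_trans ut).
have := cost_support su; rewrite cost_no_atom// => Cu.
have /andP[_] := backlog_increment F mu_gt0 ut.
rewrite Hu subrr addr0 => yt.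
have yu : 0 < y u.
  have /andP[yu _] := backlog_after_start mu_gt0 F_itv u0.
  by apply: lt_le_trans yu; rewrite mulr_gt0 ?expR_gt0// Hu.
(* Otherwise the positive backlog at [u] would decay strictly until [t] with [H] unchanged, and the
   cost at [t] would fall below [c]. *)
have tu : t <= u.
  rewrite leNgt; apply/negP => tu.
  have e1 : expR (- (mu * (t - u))) < 1.
    by rewrite -expR0 ltr_expR oppr_lt0 mulr_gt0// subr_gt0.
  have : a * y t <= a * (expR (- (mu * (t - u))) * y u) by rewrite ler_pM2l.
  have : a * (expR (- (mu * (t - u))) * y u) < a * y u.
    by rewrite ltr_pM2l// gtr_pMl.
  by move: Ct; rewrite -Hu -Cu; lra.
by have -> : t = u by apply/eqP; rewrite eq_le tu ut.
Qed.

(** In the indifferent case [y t >= e H t] gives [(a e + g) H t <= p0 (a + g) / 2], and the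
    threshold inequality says [(a + g) / 2 <= a e + g]; hence [H t <= p0]. *)
Lemma idle_before t : 0 <= t <= T -> a * (1 - 2 * expR (- (mu * t))) <= g -> H t = p0.
Proof.
move=> /andP[t0 tT] tg.
have [->|tn0] := eqVneq t 0; first exact: cdf_at0 F_itv.
have t_gt0 : 0 < t by rewrite lt_def tn0.
have [|[]//|E] := @dichotomy t; first by rewrite t_gt0.
have /andP[yt _] := backlog_after_start mu_gt0 F_itv t0.
apply/eqP; rewrite eq_le cdf_ge_atom0// andbT.
set e := expR _ in yt tg.
have e0 : 0 < e := expR_gt0 _.
have ae : 0 < a * e + g by rewrite addr_gt0// mulr_gt0.
rewrite -(ler_pM2l ae).
have : a * (e * H t) <= a * y t by rewrite ler_pM2l.
move: E; rewrite equilibrium_cost => E.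
have := atom_ge0 F 0.
nra.
Qed.

(** In the case without arrivals the threshold inequality holds in both directions, and its equality
    is again indifference. *)
Lemma indifferent_after t : 0 < t <= T -> g <= a * (1 - 2 * expR (- (mu * t))) ->
  a * y t + g * H t = p0 / 2 * (a + g).
Proof.
move=> tT gt; have [[Ht [tg yt]]|->] := dichotomy tT; last exact: equilibrium_cost.
rewrite Ht yt.
have : a * (1 - 2 * expR (- (mu * t))) = g by apply/eqP; rewrite eq_le tg gt.
by move=> <-; field.
Qed.

End Necessary.

(** * Quadratic error estimates *)

Section Rates.
Context (R : realType) (mu q k h : R).
Hypotheses (mu_gt0 : 0 < mu) (q_gt0 : 0 < q) (k_def : k * (1 + q) = mu * q).
Hypothesis h_ge0 : 0 <= h.

Let k_ge0 : 0 <= k.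
Proof. by rewrite -(pmulr_lge0 k (_ : 0 < 1 + q)) ?k_def ?mulr_ge0 ?ltW// ltr_wpDl. Qed.

Let E := expR (- (mu * h)).
Let K := expR (- (k * h)).

Let E_lo : 1 - mu * h <= E := expRN_ge1B (mu * h).
Let K_lo : 1 - k * h <= K := expRN_ge1B (k * h).
Let E_hi : E <= 1 - mu * h + (mu * h) ^+ 2.
Proof. by apply: expRN_le_quadratic; rewrite mulr_ge0// ltW. Qed.
Let K_hi : K <= 1 - k * h + (k * h) ^+ 2.
Proof. by apply: expRN_le_quadratic; rewrite mulr_ge0. Qed.
Let kh : (1 + q) * (k * h) = q * (mu * h).
Proof. by rewrite mulrA [_ * k]mulrC k_def; ring. Qed.
Let x_ge0 : 0 <= mu * h. Proof. by rewrite mulr_ge0// ltW. Qed.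
Let kh_ge0 : 0 <= k * h. Proof. by rewrite mulr_ge0. Qed.
Let E_ge0 : 0 <= E := expR_ge0 _.

(* If [a y + g H] stays constant while [H] grows by [d], then [y] drops by [q d],
   where [q = g / a]. *)
Lemma indifferent_rate (y d : R) : 0 <= y <= 1 -> 0 <= d ->
  E * (y + d) <= y - q * d <= E * y + d ->
  `|y - q * d - K * y| <= (mu ^+ 2 + k ^+ 2) * h ^+ 2.
Proof.
move=> /andP[y0 y1] d0 /andP[lo hi].
have -> : (mu ^+ 2 + k ^+ 2) * h ^+ 2 = (mu * h) ^+ 2 + (k * h) ^+ 2 by ring.
have q0 := q_gt0; have q1 : 0 < 1 + q by lra.
(* From here only the estimates of the two exponentials matter; with [x = mu h] and [z = k h] the
   rest is polynomial arithmetic. *)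
move: E_lo E_hi K_lo K_hi kh x_ge0 kh_ge0 E_ge0 lo hi.
move: E K (mu * h) (k * h) => e c x z e1 e2 c1 c2 zx x0 z0 e0 lo hi.
rewrite ler_norml; apply/andP; split.
  (* The factor [1 + q] gives access to the relation [(1 + q) z = q x] between the two rates. *)
  rewrite -subr_ge0 -(pmulr_rge0 _ q1).
  have B1 : (1 + q) * (y * (z - z ^+ 2)) <= (1 + q) * (y * (1 - c)).
    by rewrite ler_pM2l// ler_wpM2l//; lra.
  have B2 : y * (1 - e) <= y * x by rewrite ler_wpM2l//; lra.
  have B3 : q * d <= y * x by have := mulr_ge0 e0 d0; lra.
  have B4 : d * (1 - x) <= d * e by rewrite ler_wpM2l//; lra.
  have B5 : x * (q * d) <= x * (y * x) by rewrite ler_wpM2l.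
  have B6 : (1 + q) * (q * d) <= q * (y * x) + x * (q * d) by nra.
  have B7 : y * (x * x) <= x * x by rewrite ler_piMl// mulr_ge0.
  have B8 : y * (z * z) <= z * z by rewrite ler_piMl// mulr_ge0.
  have B9 : (1 + q) * (y * (z * z)) <= (1 + q) * (z * z) by rewrite ler_pM2l.
  have B10 : 0 <= q * (x * x) by rewrite mulr_ge0 ?(ltW q_gt0)// mulr_ge0.
  have B11 : y * ((1 + q) * z) = y * (q * x) by rewrite zx.
  rewrite !expr2 in B1 *.
  lra.
rewrite -subr_ge0 -(pmulr_rge0 _ q1).
have B1 : (1 + q) * (y * (1 - c)) <= (1 + q) * (y * z).
  by rewrite ler_pM2l// ler_wpM2l//; lra.
have B2 : y * (x - x * x) <= y * (1 - e).
  by rewrite ler_wpM2l//; rewrite expr2 in e2; lra.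
have B3 : q * (y * (x - x * x)) <= q * ((1 + q) * d).
  by rewrite ler_pM2l//; lra.
have B7 : q * (y * (x * x)) <= q * (x * x) by rewrite ler_pM2l// ler_piMl// mulr_ge0.
have B8 : 0 <= z * z by rewrite mulr_ge0.
have B9 : 0 <= (1 + q) * (z * z) by rewrite mulr_ge0// ltW.
have B11 : y * ((1 + q) * z) = y * (q * x) by rewrite zx.
rewrite !expr2.
lra.
Qed.

(* [v] is the claimed backlog at the start of a step of length [h] and [y0], [y1]
   are the true ones at its ends. *)
Lemma ramp_rate (v d y1 y0 : R) : 0 <= v <= 1 -> q * d = v - K * v ->
  E * (y0 + d) <= y1 <= E * y0 + d ->
  `|(y1 - K * v) - E * (y0 - v)| <= (mu ^+ 2 + mu * k + mu * k / q) * h ^+ 2.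
Proof.
move=> /andP[v0 v1] qd /andP[lo hi].
have -> : (mu ^+ 2 + mu * k + mu * k / q) * h ^+ 2 =
    (mu * h) ^+ 2 + (mu * h) * (k * h) + (mu * h) * (k * h) / q by field; rewrite gt_eqF.
have q0 := q_gt0; have q1 : 0 < 1 + q by lra.
have : K <= 1 by exact: expRN_le1.
move: E_lo E_hi K_lo K_hi kh x_ge0 kh_ge0 E_ge0 qd lo hi.
move: E K (mu * h) (k * h) => e c x z e1 e2 c1 c2 zx x0 z0 e0 qd lo hi c3.
have xz0 : 0 <= x * z by rewrite mulr_ge0.
have qxz : q * (x * z / q) = x * z by field; rewrite gt_eqF.
have vxz : v * (x * z) <= x * z by rewrite ler_piMl.
have x2 : 0 <= x * x by rewrite mulr_ge0.
have vx2 : v * (x * x) <= x * x by rewrite ler_piMl.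
have qx2 : 0 <= q * (x * x) by rewrite mulr_ge0// ltW.
have qvx2 : q * (v * (x * x)) <= q * (x * x) by rewrite ler_pM2l.
have qxz0 : 0 <= q * (x * z) by rewrite mulr_ge0// ltW.
have zxv : v * ((1 + q) * z) = v * (q * x) by rewrite zx.
rewrite ler_norml; apply/andP; split.
  (* After multiplication by [q] the growth [d] enters as [q * d = v - K * v]. *)
  rewrite -subr_ge0 -(pmulr_rge0 _ q_gt0).
  have B1 : q * (v * (1 - x)) <= q * (v * e).
    by rewrite ler_pM2l// ler_wpM2l//; lra.
  have B2 : (1 + q) * (v * c) <= (1 + q) * (v * (1 - z + z * z)).
    by rewrite ler_pM2l// ler_wpM2l//; rewrite expr2 in c2; lra.
  have B3 : (1 - e) * (q * d) <= x * (q * d).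
    apply: ler_wpM2r; last lra.
    by rewrite qd; have := mulr_ge0 v0 (_ : 0 <= 1 - c); lra.
  have B4 : x * (q * d) <= x * (v * z).
    by rewrite ler_wpM2l// qd; have := ler_wpM2l v0 (_ : 1 - c <= z); lra.
  have B5 : q * (e * (y0 + d)) <= q * y1 by rewrite ler_pM2l.
  have B6 : v * ((1 + q) * z) * z = v * (q * x) * z by rewrite zx.
  have B7 : q * (v * (x * z)) <= q * (x * z) by rewrite ler_pM2l.
  rewrite !expr2.
  lra.
rewrite -subr_ge0 -(pmulr_rge0 _ q_gt0).
have B1 : q * (v * e) <= q * (v * (1 - x + x * x)).
  by rewrite ler_pM2l// ler_wpM2l//; rewrite expr2 in e2; lra.
have B2 : (1 + q) * (v * (1 - z)) <= (1 + q) * (v * c).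
  by rewrite ler_pM2l// ler_wpM2l.
have B5 : q * y1 <= q * (e * y0 + d) by rewrite ler_pM2l.
rewrite !expr2.
lra.
Qed.

End Rates.

(** * Equilibria with a delayed continuous part *)

Lemma finite_union_of_intervals_itvI (R : realType) (A : set R) (a b : R) :
  finite_union_of_intervals A -> finite_union_of_intervals (A `&` `[a, b]%classic).
Proof.
move=> [s [_ ->]].
pose s' := [seq (Num.max i.1 a, Num.min i.2 b) | i : R * R <- s].
(* Clipping to [[a, b]] reverses the endpoints of an interval that misses it; the filter discards
   these. *)
exists [seq i <- s' | i.1 <= i.2]; split => [i|].
  by rewrite mem_filter => /andP[].
apply/seteqP; split => x /=; rewrite in_itv/=.
  move=> [[i si /andP[ix xi]] /andP[ax xb]].
  have cx : Num.max i.1 a <= x <= Num.min i.2 b by rewrite ge_max le_min ix ax xi xb.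
  exists (Num.max i.1 a, Num.min i.2 b) => //=.
  rewrite mem_filter/= map_f// andbT; case/andP: cx; exact: le_trans.
move=> [j]; rewrite mem_filter => /andP[_ /mapP[i si ->]]/=.
rewrite ge_max le_min => /andP[/andP[ix ax] /andP[xi xb]].
by rewrite ax xb; split => //; exists i; rewrite ?ix.
Qed.

Section Ramp.
Context (R : realType) (a g mu T te k : R).
Hypotheses (a_gt0 : 0 < a) (g_gt0 : 0 < g) (mu_gt0 : 0 < mu).
Hypotheses (te_gt0 : 0 < te) (teT : te < T).
Hypothesis te_def : a * (1 - 2 * expR (- (mu * te))) = g.
Hypothesis k_def : k * (a + g) = mu * g.

(* The cdf on [te, T], divided by the mass at [0]. *)
Definition ramp (t : R) := ((a + g) - (a - g) * expR (- (k * (t - te)))) / (2 * g).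

Let q := g / a.
Let q_gt0 : 0 < q. Proof. exact: divr_gt0. Qed.
Let kq : k * (1 + q) = mu * q.
Proof.
have -> : mu * q = (mu * g) / a by rewrite mulrA.
by rewrite -k_def /q; field; rewrite gt_eqF.
Qed.
Let k_gt0 : 0 < k.
Proof. by rewrite -(pmulr_lgt0 k (_ : 0 < a + g)) ?k_def ?mulr_gt0// addr_gt0. Qed.
Let T_gt0 : 0 < T. Proof. exact: lt_trans teT. Qed.
Let ag : 0 < a - g.
Proof.
rewrite subr_gt0 -te_def gtr_pMr// ltrBlDr ltrDl.
by rewrite mulr_gt0// expR_gt0.
Qed.

Let before t : t <= te -> a * (1 - 2 * expR (- (mu * t))) <= g.
Proof.
move=> tte; rewrite -te_def ler_pM2l// lerB// ler_pM2l//.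
by rewrite ler_expR lerN2 ler_pM2l.
Qed.

Let after t : te <= t -> g <= a * (1 - 2 * expR (- (mu * t))).
Proof.
move=> tte; rewrite -te_def ler_pM2l// lerB// ler_pM2l//.
by rewrite ler_expR lerN2 ler_pM2l.
Qed.

Let ramp_lt : {homo ramp : s t / s < t}.
Proof.
move=> s t st; rewrite /ramp ltr_pM2r ?invr_gt0 ?mulr_gt0// ltrD2l ltrN2.
by rewrite ltr_pM2l// ltr_expR ltrN2 ltr_pM2l// ltrD2r.
Qed.

(** * The cdf forced by indifference *)

Section RampNecessary.
Context (c : R) (F : law R).
Hypothesis F_itv : F `[0, T]%classic = 1%E.
Hypothesis cost_support : forall t, Defs.support F t -> reduced_cost a g mu F t = c.
Hypothesis cost_min : forall t, 0 <= t <= T -> c <= reduced_cost a g mu F t.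

Notation H := (cdf_at F).
Notation y := (backlog mu F).
Notation p0 := (atom F 0).

Lemma equilibrium_cdf_before t : 0 <= t <= te -> H t = p0.
Proof.
move=> /andP[t0 tte]; apply: (idle_before a_gt0 g_gt0 mu_gt0 T_gt0 F_itv cost_support cost_min).
  by rewrite t0/= (le_trans tte)// ltW.
exact: before.
Qed.

Let balance t : te <= t <= T -> a * y t + g * H t = p0 / 2 * (a + g).
Proof.
move=> /andP[tet tT].
apply: (indifferent_after a_gt0 g_gt0 mu_gt0 T_gt0 F_itv cost_support cost_min).
  by rewrite (lt_le_trans te_gt0).
exact: after.
Qed.

(** Indifference at both ends of a step makes [y] drop by [q] times the growth of [H], the situation
    of [indifferent_rate]. *)
Lemma equilibrium_backlog t : te <= t <= T -> y t = expR (- (k * (t - te))) * y te.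
Proof.
apply: (@exponential_decay _ y k te T (mu ^+ 2 + k ^+ 2)); first exact: ltW.
move=> s u tes su uT.
have /andP[lo hi] := backlog_increment F mu_gt0 su.
have d0 : 0 <= H u - H s by rewrite subr_ge0 cdf_at_mono.
have yE : y u = y s - q * (H u - H s).
  have Bs : a * y s + g * H s = p0 / 2 * (a + g) by apply: balance; rewrite tes (le_trans su).
  have Bu : a * y u + g * H u = p0 / 2 * (a + g) by apply: balance; rewrite uT (le_trans tes).
  apply: (mulfI (lt0r_neq0 a_gt0)).
  have -> : a * (y s - q * (H u - H s)) = a * y s - g * (H u - H s).
    by rewrite /q; field; rewrite gt_eqF.
  by lra.
rewrite yE; apply: indifferent_rate => //.
- by rewrite subr_ge0.
- by rewrite backlog_ge0 (le_trans (backlog_le F mu_gt0 s))// cdf_at_le1.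
- by rewrite -yE lo hi.
Qed.

(** Solve the balance at [t] for [H t]; the balance at [te], where [H te = p0], supplies the initial
    backlog. *)
Lemma equilibrium_cdf_after t : te <= t <= T -> H t = p0 * ramp t.
Proof.
move=> tI; have Ht := balance tI; have Hte := balance (_ : te <= te <= T).
have /Hte {}Hte : te <= te <= T by rewrite lexx ltW.
rewrite (equilibrium_backlog tI) in Ht.
rewrite equilibrium_cdf_before ?lexx ?ltW// in Hte.
apply: (mulfI (lt0r_neq0 g_gt0)).
have -> : g * (p0 * ramp t) = p0 / 2 * (a + g) -
   expR (- (k * (t - te))) * (p0 / 2 * (a + g) - g * p0).
  by rewrite /ramp; field; rewrite gt_eqF.
by rewrite -{2}Hte; lra.
Qed.

Lemma equilibrium_atom0 : p0 * ramp T = 1.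
Proof.
rewrite -equilibrium_cdf_after ?lexx ?ltW//.
exact: cdf_at_ge F_itv _ _.
Qed.

End RampNecessary.

(** * Verification that the ramp is an equilibrium *)

Section RampSufficient.
Context (F : law R).
Notation H := (cdf_at F).
Notation y := (backlog mu F).
Notation p0 := (atom F 0).
Hypothesis F_itv : F `[0, T]%classic = 1%E.
Hypothesis p0_gt0 : 0 < p0.
Hypothesis atomless : forall t, 0 < t <= T -> atom F t = 0.
Hypothesis cdf_before : forall t, 0 <= t <= te -> H t = p0.
Hypothesis cdf_after : forall t, te <= t <= T -> H t = p0 * ramp t.

(** Some support point [u <= t] has the same cdf value as [t], and strict growth of the ramp forces
    [u = t]. *)
Let support_after t : te < t <= T -> Defs.support F t.
Proof.
move=> /andP[tet tT].
have Ht : H te < H t.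
  rewrite (cdf_after (_ : te <= te <= T)) ?lexx ?(ltW teT)//.
  by rewrite (cdf_after (_ : te <= t <= T)) ?(ltW tet)// ltr_pM2l// ramp_lt.
have [u [teu ut su Hu]] := support_cdf_eq Ht.
have [<-//|ut'] := eqVneq u t.
have : H u < H t.
  rewrite (cdf_after (_ : te <= u <= T)) ?(ltW teu) ?(le_trans ut)//.
  rewrite (cdf_after (_ : te <= t <= T)) ?(ltW tet)// ltr_pM2l// ramp_lt//.
  by rewrite lt_neqAle ut'.
by rewrite Hu ltxx.
Qed.

Lemma ramp_support : Defs.support F = [set t | t = 0 \/ te <= t <= T].
Proof.
apply/seteqP; split => t /=.
  move=> st; have /andP[t0 tT] := support_itv F_itv st.
  have [tet|tte] := leP te t; [by right|left].
  apply/eqP; apply: contraT => tn0; exfalso.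
  have tU : (`]0, te[%classic : set R) t by rewrite /= in_itv/= tte lt_def tn0 t0.
  apply: (open_null_not_support (itv_open _ _) tU _ st).
  apply/eqP; rewrite eq_le measure_ge0 andbT.
  have <- : F `]0, te]%classic = 0%E.
    by rewrite cdf_at_sub ?ltW// !cdf_before ?lexx ?(ltW te_gt0)// subrr.
  by rewrite le_measure ?inE//; exact: subset_itvW.
move=> [->|/andP[]]; first exact: support_atom.
rewrite le_eqVlt => /orP[/eqP <- _|tet tT]; last by apply: support_after; rewrite tet.
move=> U [oU Ute].
have /nbhs_ballP[e /= e0 eU] := open_nbhs_nbhs (conj oU Ute).
(* The point [te] is a limit of support points from the right; the minimum keeps [u] within [T]. *)
pose u := Num.min T (te + e / 2).
have teu : te < u by rewrite lt_min teT ltrDl divr_gt0.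
apply: (@support_after u); first by rewrite teu ge_min lexx.
split => //; apply: eU; rewrite /ball/= distrC ger0_norm ?subr_ge0 ?(ltW teu)//.
by rewrite ltrBlDr gt_min; apply/orP; right; lra.
Qed.

Lemma ramp_admissible : admissible T F.
Proof.
split => // u v; apply: finite_union_of_intervals_itvI; rewrite ramp_support.
exists [:: (0, 0); (te, T)]; split.
  by move=> i; rewrite !inE => /orP[] /eqP->//=; exact: ltW.
apply/seteqP; split => t /=.
  move=> [->|tI]; first by exists (0, 0); rewrite ?inE ?eqxx//= lexx.
  by exists (te, T); rewrite ?inE ?eqxx ?orbT.
move=> [i]; rewrite !inE => /orP[] /eqP->/=; last by right.
by move=> t0; left; apply/eqP; rewrite eq_le andbC.
Qed.

Lemma ramp_cost_before t : 0 < t <= te ->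
  reduced_cost a g mu F t = p0 * (a * expR (- (mu * t)) + g).
Proof.
move=> /andP[t0 tte]; rewrite /reduced_cost atomless; last first.
  by rewrite t0 (le_trans tte)// ltW.
have Ht : H t = p0 by apply: cdf_before; rewrite tte ltW.
have := backlog_after_start mu_gt0 F_itv (ltW t0).
rewrite Ht subrr addr0 => yt.
have -> : y t = expR (- (mu * t)) * p0 by apply/eqP; rewrite eq_le andbC.
by field.
Qed.

(** By [ramp_rate] the gap between the true and the claimed backlog decays at rate [mu] up to a
    quadratic error. It is 0 at [te], hence everywhere. *)
Lemma ramp_backlog t : te <= t <= T ->
  y t = expR (- (k * (t - te))) * (p0 * ((a - g) / (2 * a))).
Proof.
move=> tI.
(* The constant is the backlog at [te]: nobody arrives in []0, te]], and [te_def] gives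
   [expR (- (mu * te)) = (a - g) / (2 a)]. *)
pose v t := expR (- (k * (t - te))) * (p0 * ((a - g) / (2 * a))).
have c1 : 0 <= p0 * ((a - g) / (2 * a)) <= 1.
  have c0 : 0 <= (a - g) / (2 * a).
    by rewrite divr_ge0 ?(ltW ag)// mulr_ge0// ltW.
  rewrite mulr_ge0 ?(ltW p0_gt0)//= mulr_ile1// ?(ltW p0_gt0)//.
    by rewrite -(cdf_at0 F_itv) cdf_at_le1.
  rewrite ler_pdivrMr ?mulr_gt0//.
  have := a_gt0; have := g_gt0; lra.
have step s u : te <= s -> s <= u -> u <= T ->
    `|(y u - v u) - expR (- (mu * (u - s))) * (y s - v s)|
    <= (mu ^+ 2 + mu * k + mu * k / q) * (u - s) ^+ 2.
  move=> tes su uT.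
  have vK : v u = expR (- (k * (u - s))) * v s.
    by rewrite /v [RHS]mulrA -expRD; congr (expR _ * _); ring.
  rewrite vK; apply: (ramp_rate mu_gt0 q_gt0 kq _ (d := H u - H s)) => //.
  - by rewrite subr_ge0.
  - have es : expR (- (k * (s - te))) <= 1.
      by rewrite expRN_le1// mulr_ge0 ?(ltW k_gt0)// subr_ge0.
    case/andP: c1 => c0 c1.
    by rewrite /v mulr_ge0 ?expR_ge0//= mulr_ile1 ?expR_ge0.
  - rewrite -vK (cdf_after (_ : te <= u <= T)) ?uT ?(le_trans tes)//.
    rewrite (cdf_after (_ : te <= s <= T)) ?tes ?(le_trans su)//.
    by rewrite /q /ramp /v; field; rewrite !gt_eqF.
  - exact: backlog_increment.
have := exponential_decay (ltW mu_gt0) step tI.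
have yte : y te = v te.
  have := backlog_after_start mu_gt0 F_itv (ltW te_gt0).
  rewrite (cdf_before (_ : 0 <= te <= te)) ?lexx ?(ltW te_gt0)// subrr addr0 => yt.
  have -> : y te = expR (- (mu * te)) * p0 by apply/eqP; rewrite eq_le andbC.
  rewrite /v subrr mulr0 oppr0 expR0 mul1r mulrC; congr (_ * _).
  by rewrite -te_def; field; rewrite gt_eqF.
by rewrite yte subrr mulr0 => /eqP; rewrite subr_eq0 => /eqP.
Qed.

Lemma ramp_cost_after t : te <= t <= T -> reduced_cost a g mu F t = p0 / 2 * (a + g).
Proof.
move=> tI; have /andP[tet tT] := tI.
rewrite /reduced_cost atomless ?(lt_le_trans te_gt0)// ramp_backlog// cdf_after//.
by rewrite /ramp; field; rewrite !gt_eqF.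
Qed.

Lemma ramp_cost_support t : Defs.support F t -> reduced_cost a g mu F t = p0 / 2 * (a + g).
Proof.
by rewrite ramp_support => -[->|]; [exact: cost_at0 F_itv|exact: ramp_cost_after].
Qed.

Lemma ramp_cost_min t : 0 <= t <= T -> p0 / 2 * (a + g) <= reduced_cost a g mu F t.
Proof.
move=> /andP[t0 tT]; have [tet|tte] := leP te t.
  by rewrite ramp_cost_after// tet.
have [->|tn0] := eqVneq t 0; first by rewrite (cost_at0 a g mu_gt0 F_itv).
rewrite ramp_cost_before ?lt_def ?tn0 ?t0 ?(ltW tte)//.
(* Before [te] the threshold inequality reads [(a + g) / 2 <= a e + g]. *)
have := before (ltW tte); set e := expR _ => ae.
have -> : p0 / 2 * (a + g) = p0 * ((a + g) / 2) by field.
by rewrite ler_pM2l//; lra.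
Qed.

End RampSufficient.
End Ramp.

(** * Construction of the equilibrium law *)

Section AtomDensity.
Context (R : realType) (p : R) (f : R -> R).

Definition density (B : set (measurableTypeR R)) : \bar R :=
  (\int[lebesgue_measure]_(x in B) (f x)%:E)%E.

Hypotheses (p_ge0 : 0 <= p) (f_ge0 : forall x, 0 <= f x).
Hypothesis mf : measurable_fun [set: R] f.
Hypothesis total : (p%:E + \int[lebesgue_measure]_x (f x)%:E = 1)%E.

Let density0 : density set0 = 0%E.
Proof. by rewrite /density integral_set0. Qed.

Let density_ge0 A : (0 <= density A)%E.
Proof. by apply: integral_ge0 => x _; rewrite lee_fin. Qed.

Let density_sigma_additive : semi_sigma_additive density.
Proof.
move=> /= F mF tF mUF; rewrite /density; apply: cvg_toP.
  apply: ereal_nondecreasing_is_cvgn => m n mn.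
  apply: lee_sum_nneg_natr => // k _ _; apply: integral_ge0 => /= x Fkx.
  by rewrite lee_fin.
rewrite ge0_integral_bigcup//=.
- by apply/measurable_funTS/measurableT_comp.
- by move=> x _; rewrite lee_fin.
Qed.

HB.instance Definition _ := isMeasure.Build _ _ _ density
  density0 density_ge0 density_sigma_additive.

Definition atom_density : set (measurableTypeR R) -> \bar R :=
  measure_add (mscale (NngNum p_ge0) \d_(0 : measurableTypeR R)) density.

HB.instance Definition _ := Measure.on atom_density.

Let atom_densityE B : atom_density B = (p%:E * \d_(0%R : measurableTypeR R) B + density B)%E.
Proof. by rewrite /atom_density measure_addE. Qed.

Let atom_densityT : atom_density setT = 1%E.
Proof. by rewrite atom_densityE diracT mule1. Qed.

HB.instance Definition _ := @Measure_isProbability.Build _ _ R atom_density atom_densityT.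

(** Packaged as an existence statement, so that later arguments use only the values on sets. *)
Lemma atom_density_law : exists F : law R, forall B : set (measurableTypeR R),
  F B = (p%:E * \d_(0%R : measurableTypeR R) B +
         \int[lebesgue_measure]_(x in B) (f x)%:E)%E.
Proof. by exists (atom_density : law R) => B; rewrite [LHS]atom_densityE. Qed.

End AtomDensity.

Section RampLaw.
Context (R : realType) (a g T te k : R).
Hypotheses (g_gt0 : 0 < g) (te_gt0 : 0 < te) (teT : te < T).
Hypothesis ag : g < a.
Hypothesis k_gt0 : 0 < k.
Context (p : R).
Hypothesis p_ramp : p * ramp a g te k T = 1.
Hypothesis p_gt0 : 0 < p.

Let W := ramp a g te k.
(** The derivative of [p * W], smooth on the whole line, so that the fundamental theorem of calculus
    applies up to the endpoints. *)
Let f0 t := p * (k * (a - g) / (2 * g)) * expR (- (k * (t - te))).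
Definition ramp_density (t : R) : R := f0 t * \1_(`[te, T]%classic) t.

Let continuous_exp : continuous (fun t : R => expR (- (k * (t - te)))).
Proof.
move=> x; apply: continuous_comp; last exact: continuous_expR.
by apply: cvgN; apply: cvgMr; apply: cvgB; [exact: cvg_id|exact: cvg_cst].
Qed.

Let continuous_f0 : continuous f0.
Proof. by move=> x; apply: cvgMr; exact: continuous_exp. Qed.

Let f0_ge0 t : 0 <= f0 t.
Proof.
rewrite /f0 mulr_ge0 ?expR_ge0// mulr_ge0 ?(ltW p_gt0)// divr_ge0//.
  by rewrite mulr_ge0 ?(ltW k_gt0)// subr_ge0 ltW.
by rewrite mulr_ge0// ltW.
Qed.

Let ramp_density_ge0 t : 0 <= ramp_density t.
Proof. by rewrite mulr_ge0. Qed.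

Let measurable_ramp_density : measurable_fun [set: R] ramp_density.
Proof.
apply: measurable_funM; first exact: continuous_measurable_fun.
exact: measurable_indic.
Qed.

Let pW (t : R) : is_derive t 1 (fun t => p * W t) (f0 t).
Proof.
rewrite /W /ramp.
apply: is_derive_eq.
by rewrite /f0 /GRing.scale/=; field; rewrite gt_eqF.
Qed.

Let continuous_pW : continuous (fun t => p * W t).
Proof.
move=> x; apply: differentiable_continuous.
by apply/derivable1_diffP; apply: ex_derive; exact: pW.
Qed.

Let integral_ramp_density s t : te <= s -> s < t -> t <= T ->
  (\int[lebesgue_measure]_(x in `[s, t]) (ramp_density x)%:E)%E = (p * W t - p * W s)%:E.
Proof.
move=> tes st tT.
transitivity (\int[lebesgue_measure]_(x in `[s, t]) (f0 x)%:E)%E.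
  apply: eq_integral => x; rewrite inE/= in_itv/= => /andP[sx xt].
  rewrite /ramp_density indicE mem_set ?mulr1//= in_itv/=.
  by rewrite (le_trans tes)//= (le_trans xt).
rewrite EFinB; apply: (@continuous_FTC2 _ f0 (fun t => p * W t)) => //.
- by apply: continuous_subspaceT => x; exact: continuous_f0.
- split.
  + by move=> x _; apply: ex_derive; exact: pW.
  + exact/cvg_at_right_filter/continuous_pW.
  + exact/cvg_at_left_filter/continuous_pW.
- by move=> x _; rewrite derive1E; apply: derive_val; exact: pW.
Qed.

(** The density integrates to [p W T - p W te = 1 - p], as [W te = 1]. *)
Let total : (p%:E + \int[lebesgue_measure]_x (ramp_density x)%:E = 1)%E.
Proof.
rewrite (_ : (\int[lebesgue_measure]_x _)%E =
    \int[lebesgue_measure]_(x in `[te, T]) (ramp_density x)%:E)%E.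
  rewrite integral_ramp_density// -EFinD p_ramp.
  rewrite /W /ramp subrr mulr0 oppr0 expR0; congr _%:E; field.
  by rewrite gt_eqF.
rewrite [RHS]integral_mkcond; apply: eq_integral => x _.
rewrite patchE; case: ifPn => // xI.
by rewrite /ramp_density indicE (negbTE xI) mulr0.
Qed.

Lemma ramp_law : exists F : law R,
  [/\ F [set 0] = p%:E,
      F `[0, T]%classic = 1%E &
      forall B : set (measurableTypeR R), measurable B -> B `<=` `]0, T]%classic ->
        F B = (\int[lebesgue_measure]_(t in B) (ramp_density t)%:E)%E].
Proof.
have [F FE] := atom_density_law (ltW p_gt0) ramp_density_ge0 measurable_ramp_density total.
exists F; split.
- by rewrite FE integral_set1 adde0 diracE mem_set// mule1.
- rewrite FE diracE mem_set/=; last by rewrite in_itv/= lexx (ltW (lt_trans te_gt0 teT)).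
  rewrite mule1 -total; congr (_ + _)%E.
  rewrite [LHS]integral_mkcond; apply: eq_integral => x _.
  rewrite patchE; case: ifPn => // xI.
  rewrite /ramp_density indicE memNset ?mulr0//= in_itv/= => /andP[tex xT].
  by move: xI; rewrite mem_setE in_itv/= xT (le_trans (ltW te_gt0)).
- move=> B mB B0; rewrite FE diracE memNset ?mule0 ?add0e// => /B0/=.
  by rewrite in_itv/= ltxx.
Qed.

Context (F : law R).
Hypothesis F0 : F [set 0] = p%:E.
Hypothesis F_itv : F `[0, T]%classic = 1%E.
Hypothesis F_density : forall B : set (measurableTypeR R), measurable B ->
  B `<=` `]0, T]%classic -> F B = (\int[lebesgue_measure]_(t in B) (ramp_density t)%:E)%E.

Lemma ramp_law_atom0 : atom F 0 = p.
Proof. by rewrite /atom F0. Qed.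

Lemma ramp_law_atomless t : 0 < t <= T -> atom F t = 0.
Proof.
move=> tI; rewrite /atom F_density//; first by rewrite integral_set1.
by move=> _ ->; rewrite /= in_itv.
Qed.

Let cdf_te : cdf_at F te = p.
Proof.
have m_density D : measurable_fun D (EFin \o ramp_density : measurableTypeR R -> _).
  exact/measurable_EFinP/measurable_funTS.
have : F `]0, te]%classic = 0%E.
  rewrite F_density//; last first.
    by move=> x /=; rewrite !in_itv/= => /andP[-> xte]; rewrite (le_trans xte)// ltW.
  (* The density is nonzero at [te], so this endpoint is dropped before the integrand is replaced by
     0. *)
  rewrite -integral_itv_bndo_bndc; last exact: m_density.
  apply: integral0_eq => x /=; rewrite in_itv/= => /andP[x0 xte].
  rewrite /ramp_density indicE memNset ?mulr0//= in_itv/= => /andP[+ _].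
  by rewrite leNgt xte.
rewrite cdf_at_sub ?(ltW te_gt0)// (cdf_at0 F_itv) ramp_law_atom0 => H0.
by apply/eqP; rewrite -subr_eq0; apply/eqP/EFin_inj.
Qed.

Lemma ramp_law_cdf_before t : 0 <= t <= te -> cdf_at F t = p.
Proof.
move=> /andP[t0 tte]; apply/eqP; rewrite eq_le -{1}cdf_te cdf_at_mono//=.
by rewrite -ramp_law_atom0 -(cdf_at0 F_itv) cdf_at_mono.
Qed.

Lemma ramp_law_cdf_after t : te <= t <= T -> cdf_at F t = p * W t.
Proof.
move=> /andP[]; rewrite le_eqVlt => /orP[/eqP <- _|tet tT].
  rewrite cdf_te /W /ramp subrr mulr0 oppr0 expR0; field.
  by rewrite gt_eqF.
have m_density D : measurable_fun D (EFin \o ramp_density : measurableTypeR R -> _).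
  exact/measurable_EFinP/measurable_funTS.
have := cdf_at_sub F (ltW tet).
rewrite F_density//; last first.
  move=> x /=; rewrite !in_itv/= => /andP[tex xt].
  by rewrite (lt_trans te_gt0)//= (le_trans xt).
rewrite integral_itv_obnd_cbnd; last exact: m_density.
rewrite integral_ramp_density// cdf_te => /(congr1 fine)/= HW.
suff pE : p * W te = p by lra.
rewrite /W /ramp subrr mulr0 oppr0 expR0; field.
by rewrite gt_eqF.
Qed.

End RampLaw.

(** * Existence and uniqueness *)

Section FullAtom.
Context (R : realType) (a g mu T : R) (F : law R).
Hypothesis mu_gt0 : 0 < mu.
Hypothesis F_itv : F `[0, T]%classic = 1%E.
Hypothesis F0 : atom F 0 = 1.

Lemma full_atom_cdf t : 0 <= t -> cdf_at F t = 1.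
Proof.
move=> t0; apply/eqP; rewrite eq_le cdf_at_le1 -F0 -(cdf_at0 F_itv).
exact: cdf_at_mono.
Qed.

Lemma full_atom_support : Defs.support F = [set 0].
Proof.
apply/seteqP; split => t /=; last by move=> ->; apply: support_atom; rewrite F0.
move=> st; have /andP[t0 tT] := support_itv F_itv st.
apply/eqP; apply: contraT => tn0; exfalso.
have t1 : 0 <= t + 1 by rewrite addr_ge0.
have tU : (`]0, (t + 1)[%classic : set R) t by rewrite /= in_itv/= lt_def tn0 t0 ltrDl /=.
apply: (open_null_not_support (itv_open _ _) tU _ st).
apply/eqP; rewrite eq_le measure_ge0 andbT.
have <- : F `]0, (t + 1)%R]%classic = 0%E.
  by rewrite cdf_at_sub// !full_atom_cdf// subrr.
by rewrite le_measure ?inE//; exact: subset_itvW.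
Qed.

Lemma full_atom_cost t : 0 < t -> reduced_cost a g mu F t = a * expR (- (mu * t)) + g.
Proof.
move=> t0; have pt : atom F t = 0.
  have := atom_le F t0; rewrite !full_atom_cdf ?(ltW t0)// subrr => p0.
  by apply/eqP; rewrite eq_le p0 atom_ge0.
have := backlog_after_start mu_gt0 F_itv (ltW t0).
rewrite full_atom_cdf ?(ltW t0)// F0 subrr addr0 mulr1 => yt.
have yE : backlog mu F t = expR (- (mu * t)) by apply/eqP; rewrite eq_le andbC.
by rewrite /reduced_cost pt yE full_atom_cdf ?(ltW t0)// mul0r !subr0 mulr1.
Qed.

End FullAtom.

Lemma law_eq_cdf_itv (R : realType) (T : R) (F G : law R) :
  F `[0, T]%classic = 1%E -> G `[0, T]%classic = 1%E ->
  (forall t, 0 <= t <= T -> cdf_at F t = cdf_at G t) ->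
  forall B : set (measurableTypeR R), measurable B -> F B = G B.
Proof.
move=> F1 G1 FG; apply: law_ext => t.
have [t0|t0] := ltP t 0; first by rewrite (cdf_at_lt0 F1)// (cdf_at_lt0 G1).
have [tT|/ltW tT] := leP t T; first by rewrite FG// t0.
by rewrite (cdf_at_ge F1)// (cdf_at_ge G1).
Qed.

Section Reduction.
Context (R : realType) (alpha gamma mu T : R) (mu_gt0 : 0 < mu).
Notation reduced := (reduced_cost (alpha / mu) gamma mu).

Lemma symmetric_equilibriumE (F : law R) (c : R) :
  symmetric_equilibrium alpha gamma mu_gt0 T F c <->
  [/\ admissible T F, forall t, Defs.support F t -> reduced F t = c
    & forall t, 0 <= t <= T -> c <= reduced F t].
Proof.
have E t : expected_cost alpha gamma mu_gt0 F t = reduced F t.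
  by rewrite expected_costE.
split=> -[adm sup low]; split => // t ht.
- by rewrite -E; exact: sup.
- by rewrite -E; exact: low.
- by rewrite E; exact: sup.
- by rewrite E; exact: low.
Qed.

End Reduction.

Lemma immediate_arrival_equilibrium (R : realType) (alpha gamma mu T : R)
    (alpha_gt0 : 0 < alpha) (gamma_gt0 : 0 < gamma) (mu_gt0 : 0 < mu)
    (T_gt0 : 0 < T) :
  alpha / mu * (1 - 2 * expR (- (mu * T))) <= gamma ->
  exists F : law R, F [set 0] = 1%E /\
    unique_symmetric_equilibrium alpha gamma mu_gt0 T F (2^-1 * (alpha / mu + gamma)).
Proof.
move=> small.
have a_gt0 : 0 < alpha / mu by exact: divr_gt0.
pose F : law R := \d_(0 : measurableTypeR R).
have F0 : F [set 0] = 1%E by rewrite /F/= diracE mem_set.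
have F_itv : F `[0, T]%classic = 1%E.
  by rewrite /F/= diracE mem_set//= in_itv/= lexx ltW.
have p1 : atom F 0 = 1 by rewrite /atom F0.
exists F; split => //; split.
  apply/symmetric_equilibriumE; split.
  - split => // u v; apply: finite_union_of_intervals_itvI.
    rewrite (full_atom_support F_itv p1); exists [:: (0, 0)]; split.
      by move=> i; rewrite inE => /eqP ->/=.
    apply/seteqP; split => t /=; first by move=> ->; exists (0, 0); rewrite ?inE//= lexx.
    by move=> [i]; rewrite inE => /eqP ->/= t0; apply/eqP; rewrite eq_le andbC.
  - move=> t; rewrite (full_atom_support F_itv p1) => ->.
    by rewrite (cost_at0 _ _ mu_gt0 F_itv) p1 mul1r.
  - move=> t /andP[t0 tT]; have [->|tn0] := eqVneq t 0.
      by rewrite (cost_at0 _ _ mu_gt0 F_itv) p1 mul1r.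
    rewrite (full_atom_cost _ _ mu_gt0 F_itv p1) ?lt_def ?tn0//.
    (* The discount is smallest at [T], so the assumed inequality at [T] covers every [t]. *)
    have : expR (- (mu * T)) <= expR (- (mu * t)).
      by rewrite ler_expR lerN2 ler_pM2l.
    move/(ler_wpM2l (ltW a_gt0)); move: small.
    move: (alpha / mu) (expR _) (expR _) => a e1 e2 small le12.
    lra.
move=> G c /symmetric_equilibriumE[[G_itv _] sup low].
(* The threshold inequality holds at [T] itself, so nobody arrives after 0 and the mass at 0 equals
   the cdf at [T]. *)
have G0 : atom G 0 = 1.
  rewrite -(idle_before a_gt0 gamma_gt0 mu_gt0 T_gt0 G_itv sup low (t := T))//.
    exact: cdf_at_ge G_itv _ _.
  by rewrite lexx ltW.
split.
  apply: (law_eq_cdf_itv G_itv F_itv) => t /andP[t0 _].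
  by rewrite (full_atom_cdf G_itv)// (full_atom_cdf F_itv).
by rewrite (equilibrium_cost a_gt0 gamma_gt0 mu_gt0 T_gt0 G_itv sup low) G0 mul1r.
Qed.

Lemma ramp_equilibrium (R : realType) (alpha gamma mu T te k p : R)
    (alpha_gt0 : 0 < alpha) (gamma_gt0 : 0 < gamma) (mu_gt0 : 0 < mu)
    (a := alpha / mu) :
  0 < te -> te < T -> a * (1 - 2 * expR (- (mu * te))) = gamma ->
  k * (a + gamma) = mu * gamma -> p * ramp a gamma te k T = 1 ->
  exists F : law R,
    [/\ F [set 0] = p%:E,
        forall B : set (measurableTypeR R), measurable B -> B `<=` `]0, T]%classic ->
          F B = (\int[lebesgue_measure]_(t in B) (ramp_density a gamma T te k p t)%:E)%E
      & unique_symmetric_equilibrium alpha gamma mu_gt0 T F (p / 2 * (a + gamma))].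
Proof.
move=> te_gt0 teT te_def k_def p_ramp.
have a_gt0 : 0 < a by exact: divr_gt0.
have T_gt0 := lt_trans te_gt0 teT.
have ag : gamma < a.
  by rewrite -te_def gtr_pMr// ltrBlDr ltrDl mulr_gt0// expR_gt0.
have k_gt0 : 0 < k.
  by rewrite -(pmulr_lgt0 k (_ : 0 < a + gamma)) ?k_def ?mulr_gt0// addr_gt0.
have p_gt0 : 0 < p.
  have : 0 < ramp a gamma te k T.
    rewrite /ramp divr_gt0 ?mulr_gt0//.
    have e1 : expR (- (k * (T - te))) <= 1.
      by rewrite expRN_le1// mulr_ge0 ?ltW// subr_gt0.
    have : (a - gamma) * expR (- (k * (T - te))) <= a - gamma.
      by rewrite ler_piMr// subr_ge0 ltW.
    by lra.
  by move=> /pmulr_lgt0 <-; rewrite p_ramp.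
have [F [F0 F_itv F_dens]] := ramp_law gamma_gt0 te_gt0 teT ag k_gt0 p_ramp p_gt0.
exists F; split => //.
have p0 : atom F 0 = p by rewrite /atom F0.
have p0_gt0 : 0 < atom F 0 by rewrite p0.
have atomless := ramp_law_atomless F_dens.
have before t : 0 <= t <= te -> cdf_at F t = atom F 0.
  by rewrite p0; exact: (ramp_law_cdf_before te_gt0 teT F0 F_itv F_dens).
have after t : te <= t <= T -> cdf_at F t = atom F 0 * ramp a gamma te k t.
  by rewrite p0; exact: (ramp_law_cdf_after gamma_gt0 te_gt0 teT F0 F_itv F_dens).
split.
  rewrite -p0; apply/symmetric_equilibriumE; split.
  - exact: (ramp_admissible a_gt0 gamma_gt0 mu_gt0 te_gt0 teT te_def k_def
      F_itv p0_gt0 before after).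
  - move=> t; exact: (ramp_cost_support a_gt0 gamma_gt0 mu_gt0 te_gt0 teT te_def k_def F_itv p0_gt0
      atomless before after).
  - move=> t; exact: (ramp_cost_min a_gt0 gamma_gt0 mu_gt0 te_gt0 teT te_def k_def F_itv p0_gt0
      atomless before after).
move=> G c /symmetric_equilibriumE[[G_itv _] sup low].
(* Both masses solve the same normalisation at [T]. *)
have G0 : atom G 0 = p.
  have GT := equilibrium_atom0 a_gt0 gamma_gt0 mu_gt0 te_gt0 teT te_def k_def G_itv sup low.
  apply: (mulIf (_ : ramp a gamma te k T != 0)); last by rewrite GT p_ramp.
  by apply/eqP => r0; move: p_ramp; rewrite r0 mulr0 => /eqP; rewrite eq_sym oner_eq0.
split; last first.
  by rewrite (equilibrium_cost a_gt0 gamma_gt0 mu_gt0 T_gt0 G_itv sup low) G0.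
apply: (law_eq_cdf_itv G_itv F_itv) => t /andP[t0 tT].
have [tte|/ltW tet] := leP t te.
  rewrite before ?t0// p0 -G0.
  by rewrite (equilibrium_cdf_before a_gt0 gamma_gt0 mu_gt0 te_gt0 teT te_def G_itv sup low)// t0.
rewrite after ?tet// p0 -G0.
by rewrite (equilibrium_cdf_after a_gt0 gamma_gt0 mu_gt0 te_gt0 teT te_def k_def
  G_itv sup low)// tet.
Qed.

Theorem theorem2p4 (R : realType) (alpha gamma mu T : R)
    (alpha_gt0 : 0 < alpha) (gamma_gt0 : 0 < gamma) (mu_gt0 : 0 < mu)
    (T_gt0 : 0 < T) :
  (alpha / mu * (1 - 2 * expR (- (mu * T))) <= gamma ->
    exists F : law R,
      F [set 0] = 1%E /\
      unique_symmetric_equilibrium alpha gamma mu_gt0 T F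
        (2^-1 * (alpha / mu + gamma)))
  /\
  (gamma < alpha / mu * (1 - 2 * expR (- (mu * T))) ->
    let r := alpha / (gamma * mu) in
    let te := - (1 / mu) * ln (2^-1 * (1 - gamma * mu / alpha)) in
    let p0 := 2 / (1 + r - (r - 1) * expR (- (mu / (1 + r)) * (T - te))) in
    let f := fun t : R => p0 * mu / 2 * ((r - 1) / (r + 1)) *
      expR (- (mu / (1 + r)) * (t - te)) * \1_(`[te, T]%classic) t in
    exists F : law R,
      [/\ F [set 0] = p0%:E,
          forall B : set (measurableTypeR R), measurable B -> B `<=` `]0, T]%classic ->
            F B = (\int[lebesgue_measure]_(t in B) (f t)%:E)%E
        & unique_symmetric_equilibrium alpha gamma mu_gt0 T F
            (p0 / 2 * (alpha / mu + gamma))]).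
Proof.
split; first exact: immediate_arrival_equilibrium.
move=> big r te p0 f.
have a_gt0 : 0 < alpha / mu by exact: divr_gt0.
have ag : gamma < alpha / mu.
  by apply: lt_trans big _; rewrite gtr_pMr// ltrBlDr ltrDl mulr_gt0// expR_gt0.
have aN0 := lt0r_neq0 alpha_gt0; have gN0 := lt0r_neq0 gamma_gt0.
have muN0 := lt0r_neq0 mu_gt0.
have rE : r = alpha / mu / gamma by rewrite /r; field; rewrite gN0 muN0.
have r_gt1 : 1 < r by rewrite rE ltr_pdivlMr// mul1r.
have r1N0 : 1 + r != 0 by rewrite gt_eqF// addr_gt0// (lt_trans ltr01).
(* This is the value of [expR (- (mu * te))]. *)
pose b := 2^-1 * (1 - gamma * mu / alpha).
have gm_lt1 : gamma * mu / alpha < 1.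
  by rewrite ltr_pdivrMr// mul1r -ltr_pdivlMr.
have gm_gt0 : 0 < gamma * mu / alpha by rewrite divr_gt0// mulr_gt0.
have b_gt0 : 0 < b by rewrite /b; lra.
have b_lt1 : b < 1 by rewrite /b; lra.
have mute : - (mu * te) = ln b by rewrite /te /b; field; rewrite muN0.
have ete : expR (- (mu * te)) = b by rewrite mute lnK.
have te_gt0 : 0 < te.
  by rewrite -(pmulr_rgt0 _ mu_gt0) -oppr_lt0 mute ln_lt0// b_gt0.
have te_def : alpha / mu * (1 - 2 * expR (- (mu * te))) = gamma.
  by rewrite ete /b; field; rewrite aN0 muN0.
(* By [te_def] the case hypothesis compares the same increasing function at [te] and at [T]. *)
have teT : te < T.
  move: big; rewrite -{1}te_def ltr_pM2l// ltrD2l ltrN2 ltr_pM2l// ltr_expR ltrN2.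
  by rewrite ltr_pM2l.
(* As [r = a / gamma] with [a = alpha / mu], this is [mu gamma / (a + gamma)]. *)
pose k := mu / (1 + r).
have k_gt0 : 0 < k by rewrite divr_gt0// addr_gt0// (lt_trans ltr01).
have kE t : - (mu / (1 + r)) * (t - te) = - (k * (t - te)) by rewrite mulNr.
have k_def : k * (alpha / mu + gamma) = mu * gamma.
  have -> : alpha / mu + gamma = gamma * (1 + r) by rewrite rE; field; rewrite muN0 gN0.
  by rewrite /k; field.
have p_ramp : p0 * ramp (alpha / mu) gamma te k T = 1.
  have -> : ramp (alpha / mu) gamma te k T = (1 + r - (r - 1) * expR (- (k * (T - te)))) / 2.
    by rewrite /ramp rE; field; rewrite muN0 gN0.
  rewrite /p0 kE; field.
  (* The remaining side condition holds because the denominator of [p0] is at least 2. *)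
  have e1 : expR (- (k * (T - te))) <= 1.
    by rewrite expRN_le1// mulr_ge0 ?(ltW k_gt0)// subr_ge0 ltW.
  have : (r - 1) * expR (- (k * (T - te))) <= r - 1.
    by rewrite ler_piMr// subr_ge0 ltW.
  by move=> h; rewrite gt_eqF//; lra.
have fE : f = ramp_density (alpha / mu) gamma T te k p0.
  apply/funext => t; rewrite /f /ramp_density kE; congr (_ * _ * _).
  have -> : k * (alpha / mu - gamma) / (2 * gamma) = k * ((r - 1) / 2).
    by rewrite rE; field; rewrite muN0 gN0.
  by rewrite /k; field; rewrite ?[r + 1]addrC ?r1N0.
rewrite fE; exact: ramp_equilibrium.
Qed.
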